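(* Let $p$ be an odd prime, let $n\ge3$ be an integer, and let $f:\mathbb{F}_p^n\to\mathbb{F}_p$ be a dual-bent function belonging to $\mathcal{DBF}$. Put $$U=\Big\{\{0\},\ N_0(f)\setminus\{0\},\ \bigcup_{i\in SQ}N_i(f),\ \bigcup_{i\in NSQ}N_i(f)\Big\},\qquad V=\Big\{\{0\},\ N_0(f)\setminus\{0\},\ \bigcup_{i\in\mathbb{F}_p^*}N_i(f)\Big\}.$$ Then the partition $U$ of $\mathbb{F}_p^n$ induces a symmetric association scheme if and only if $f$ is weakly regular, and the partition $V$ of $\mathbb{F}_p^n$ induces a symmetric association scheme if and only if $f$ is weakly regular and $n$ is even.
   Context: Let $p$ be an odd prime, $n$ a positive integer, $x\cdot y$ the ordinary inner product on $\mathbb{F}_p^n$, and $\xi_p=e^{2\pi\sqrt{-1}/p}$. $SQ$ and $NSQ$ denote the sets of squares and of nonsquares in $\mathbb{F}_p^*$. For $f:\mathbb{F}_p^n\to\mathbb{F}_p$ and $j\in\mathbb{F}_p$, $N_j(f)=\{x\in\mathbb{F}_p^n:f(x)=j\}$. Bent functions. For $f:\mathbb{F}_p^n\to\mathbb{F}_p$ the Walsh transform is $\mathcal{W}_f(\alpha)=\sum_{x\in\mathbb{F}_p^n}\xi_p^{f(x)-\alpha\cdot x}$, $\alpha\in\mathbb{F}_p^n$; $f$ is bent if $|\mathcal{W}_f(\alpha)|=p^{n/2}$ for all $\alpha$. Put $\mu=1$ if $p^n\equiv1\pmod 4$ and $\mu=\sqrt{-1}$ if $p^n\equiv3\pmod4$.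 For a bent $f$ it is known that for every $\alpha$, $\mathcal{W}_f(\alpha)\in\{\mu p^{n/2}\xi_p^{f^*(\alpha)},-\mu p^{n/2}\xi_p^{f^*(\alpha)}\}$ for a (unique) function $f^*:\mathbb{F}_p^n\to\mathbb{F}_p$, called the dual of $f$. A bent $f$ is weakly regular if there is $\lambda\in\{\pm1,\pm\sqrt{-1}\}$ independent of $\alpha$ with $\mathcal{W}_f(\alpha)=\lambda p^{n/2}\xi_p^{f^*(\alpha)}$ for all $\alpha$. A bent $f$ is dual-bent if $f^*$ is also bent. $\mathcal{DBF}$ is the set of dual-bent functions $f:\mathbb{F}_p^n\to\mathbb{F}_p$ such that $f(0)=0$ and there is a positive integer $h$ with $\gcd(h-1,p-1)=1$ and $f(ax)=a^hf(x)$ for all $a\in\mathbb{F}_p^*$, $x\in\mathbb{F}_p^n$. Association schemes. A $d$-class association scheme on a nonempty finite set $X$ is a partition of $X\times X$ into relations $R_0,\dots,R_d$ such that $R_0=\{(x,x):x\in X\}$; for each $j$ the transpose $R_j^T$ equals some $R_{j'}$; and for all $u,v,w$ and $(x,y)\in R_w$ the number $|\{z\in X:(x,z)\in R_u,(z,y)\in R_v\}|$ depends only on $u,v,w$. It is symmetric if $R_j^T=R_j$ for all $j$. A partition $\{U_i\}_{i=0}^d$ of $\mathbb{F}_p^n$ (into nonempty sets) with $U_0=\{0\}$ induces a symmetric association scheme if the relations $R_i=\{(\alpha,\beta):\alpha-\beta\in U_i\}$, $0\le i\le d$, form a symmetric association scheme on $\mathbb{F}_p^n$. *)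

(* Defs.v *)
(* MathComp, with R[i] over an arbitrary R : realType as the complex numbers. *)
From mathcomp Require Import all_boot all_order all_algebra.
From mathcomp Require Import complex.
From mathcomp Require Import reals trigo.

Set Implicit Arguments.
Unset Strict Implicit.
Unset Printing Implicit Defensive.

Import Order.TTheory GRing.Theory Num.Theory.
Local Open Scope ring_scope.

Definition dotp (p n : nat) (x y : 'rV['F_p]_n) : 'F_p :=
  \sum_(i < n) x 0 i * y 0 i.

Definition SQ (p : nat) : {set 'F_p} :=
  [set i | (i != 0) && [exists y : 'F_p, i == y ^+ 2]].

Definition NSQ (p : nat) : {set 'F_p} :=
  [set i | (i != 0) && ~~ [exists y : 'F_p, i == y ^+ 2]].

Definition levelset (p n : nat) (f : 'rV['F_p]_n -> 'F_p) (j : 'F_p) :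
  {set 'rV['F_p]_n} := [set x | f x == j].

(* exp (2 pi i / p) *)
Definition xi (R : realType) (p : nat) : R[i] :=
  Complex (cos (2 * pi / p%:R)) (sin (2 * pi / p%:R)).

(* An exponent in 'F_p is read as its representative in [0, p), which is
   harmless since xi ^+ p = 1. *)
Definition walsh (R : realType) (p n : nat) (f : 'rV['F_p]_n -> 'F_p)
    (a : 'rV['F_p]_n) : R[i] :=
  \sum_(x : 'rV['F_p]_n) xi R p ^+ nat_of_ord (f x - dotp a x).

(* p ^ (n / 2), as sqrt p to the power n *)
Definition phalf (R : realType) (p n : nat) : R[i] :=
  real_complex R (Num.sqrt p%:R ^+ n).

Definition bent (R : realType) (p n : nat) (f : 'rV['F_p]_n -> 'F_p) : Prop :=
  forall a : 'rV['F_p]_n, `|walsh R f a| = phalf R p n.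

(* For odd p, p ^ n is 1 or 3 modulo 4. *)
Definition mu (R : realType) (p n : nat) : R[i] :=
  if (p ^ n %% 4 == 1)%N then 1 else 'i%C.

(* g is the dual of f; such a g is unique when p is an odd prime, and it exists
   when moreover f is bent. *)
Definition is_dual (R : realType) (p n : nat) (f g : 'rV['F_p]_n -> 'F_p) :
    Prop :=
  forall a : 'rV['F_p]_n,
    walsh R f a = mu R p n * phalf R p n * xi R p ^+ nat_of_ord (g a) \/
    walsh R f a = - (mu R p n * phalf R p n * xi R p ^+ nat_of_ord (g a)).

Definition weakly_regular (R : realType) (p n : nat)
    (f : 'rV['F_p]_n -> 'F_p) : Prop :=
  bent R f /\
  exists2 g : 'rV['F_p]_n -> 'F_p, is_dual R f g &
    exists2 l : R[i], l \in [:: 1; -1; 'i%C; - 'i%C] &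
      forall a : 'rV['F_p]_n,
        walsh R f a = l * phalf R p n * xi R p ^+ nat_of_ord (g a).

Definition dual_bent (R : realType) (p n : nat)
    (f : 'rV['F_p]_n -> 'F_p) : Prop :=
  bent R f /\ exists2 g : 'rV['F_p]_n -> 'F_p, is_dual R f g & bent R g.

Definition DBF (R : realType) (p n : nat) (f : 'rV['F_p]_n -> 'F_p) : Prop :=
  [/\ dual_bent R f,
      f 0 = 0 &
      exists h : nat,
        [/\ (0 < h)%N, coprime (h - 1) (p - 1) &
            forall (a : 'F_p) (x : 'rV['F_p]_n),
              a != 0 -> f (a *: x) = a ^+ h * f x]].

(* An indexed family is a partition when its members are nonempty, pairwise
   disjoint and cover T; injectivity is needed because `partition` only sees
   the set of members. *)
Definition indexed_partition (T : finType) (d : nat) (A : 'I_d.+1 -> {set T}) :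
    Prop :=
  injective A /\ partition [set A i | i in 'I_d.+1] [set: T].

Definition transp (X : finType) (E : {set X * X}) : {set X * X} :=
  [set u | (u.2, u.1) \in E].

Record assoc_scheme (X : finType) (d : nat) (E : 'I_d.+1 -> {set X * X}) :
    Prop := AssocScheme {
  as_nonempty : (0 < #|X|)%N;
  as_partition : indexed_partition E;
  as_diag : E ord0 = [set u | u.1 == u.2];
  as_transp : forall j, exists j', transp (E j) = E j';
  as_inter : forall u v w, exists c : nat, forall x y : X, (x, y) \in E w ->
    #|[set z | ((x, z) \in E u) && ((z, y) \in E v)]| = c }.

Definition sym_assoc_scheme (X : finType) (d : nat)
    (E : 'I_d.+1 -> {set X * X}) : Prop :=
  assoc_scheme E /\ forall j, transp (E j) = E j.

Definition induces_sym_scheme (p n d : nat)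
    (P : d.+1.-tuple {set 'rV['F_p]_n}) : Prop :=
  [/\ indexed_partition (tnth P),
      tnth P ord0 = [set 0] &
      sym_assoc_scheme (fun i => [set u : 'rV['F_p]_n * 'rV['F_p]_n |
                                   u.1 - u.2 \in tnth P i])].

Definition partU (p n : nat) (f : 'rV['F_p]_n -> 'F_p) :
    4.-tuple {set 'rV['F_p]_n} :=
  [tuple [set 0]; levelset f 0 :\ 0;
         \bigcup_(i in SQ p) levelset f i; \bigcup_(i in NSQ p) levelset f i].

Definition partV (p n : nat) (f : 'rV['F_p]_n -> 'F_p) :
    3.-tuple {set 'rV['F_p]_n} :=
  [tuple [set 0]; levelset f 0 :\ 0;
         \bigcup_(i in [set i : 'F_p | i != 0]) levelset f i].

(* Main.v *)
Require Import Defs.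
From mathcomp Require Import all_boot all_order all_algebra all_solvable all_field.
From mathcomp Require Import complex.
From mathcomp Require Import reals trigo.
From mathcomp Require Import zify ring lra.

Set Implicit Arguments.
Unset Strict Implicit.
Unset Printing Implicit Defensive.

Import Order.TTheory GRing.Theory Num.Theory.
Local Open Scope ring_scope.

(** Let g be the dual of f and write eps(a) = 1 or -1 for the sign in
W_f(a) = eps(a) G^n xi^(g(a)), where G is the quadratic Gauss sum, so that
mu p^(n/2) = G^n up to a global sign; f is weakly regular iff eps is constant.
Let psi_0(t) = p [t = 0] - 1 and let psi_1 be the quadratic character. By
homogeneity and Galois conjugation of xi, the Fourier transform of psi_b o f is
an integer multiple of eps . (psi_(n+b) o g), the index being read modulo 2.

A partition into classes of f induces a scheme iff its class functions are
closed under convolution. If eps is constant this follows, because the Fourier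
transforms are then the class functions of g, which are closed under products.
Conversely, closure expresses products of A = eps psi_0(g) and B = eps psi_1(g),
away from 0, as combinations of 1, A and B; as g is bent, it takes the value 0,
squares and nonsquares away from 0, and this makes eps constant on each of the
three classes. If these three signs differ, then A or B satisfies a quadratic
equation away from 0, which gives the values of the autocorrelation of psi_b o f;
these contradict positivity (an autocorrelation is maximal at 0) or the size of
the level sets. The sign at 0 is settled by a congruence modulo p. *)

(** * Conjugating p-th roots of unity *)

(** Dividing the factorization of X^p - 1 by that of X - 1 leaves ['Phi_p], and z is not a root of X
    - 1. *)
Lemma root_Cyclotomic_prime (F : numFieldType) (p : nat) (z : F) :
  prime p -> z != 1 -> z ^+ p = 1 -> root (map_poly intr 'Phi_p) z.
Proof.
move=> p_pr z_neq1 zp1.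
have divp : divisors p = [:: 1%N; p].
  apply: (@irr_sorted_eq _ ltn ltn_trans ltnn).
  - exact: sorted_divisors_ltn.
  - by rewrite /= (prime_gt1 p_pr).
  move=> d; rewrite -dvdn_divisors ?prime_gt0 // !inE.
  apply/idP/idP; first by case/primeP: p_pr => _; apply.
  by case/orP=> /eqP ->.
have := prod_Cyclotomic (prime_gt0 p_pr).
have := @prod_Cyclotomic 1 isT.
rewrite divp !big_cons !big_nil !mulr1 => -> /(congr1 (map_poly (intr : int -> F))).
rewrite rmorphM /= !rmorphB /= !rmorph1 !map_polyXn expr1 =>
  /(congr1 (horner^~ z)) /eqP.
rewrite !hornerE zp1 subrr mulf_eq0 subr_eq0 (negPf z_neq1) /=.
exact.
Qed.

(** This is the Galois conjugation z -> z^a without automorphisms: ['Phi_p] is irreducible over the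
    rationals, so it divides P, and z^a is another of its roots. Irreducibility is read off in
    [algC] and reaches F through rational polynomials. *)
Lemma root_intr_expr_prime (F : numFieldType) (p a : nat) (z : F)
    (P : {poly int}) :
  prime p -> z != 1 -> z ^+ p = 1 -> coprime a p ->
  root (map_poly intr P) z -> root (map_poly intr P) (z ^+ a).
Proof.
move=> p_pr z_neq1 zp1 co_ap Pz.
have [w w_prim] := C_prim_root_exists (prime_gt0 p_pr).
have [q [qE _] q_min] := minCpolyP w.
have q_Phi : q = map_poly intr 'Phi_p.
  apply: (map_poly_inj (ratr : {rmorphism rat -> algC})).
  rewrite -qE (minCpoly_cyclotomic w_prim) -(Cintr_Cyclotomic w_prim).
  by rewrite -map_poly_comp; apply: eq_map_poly => i /=; rewrite ratr_int.
have toF (Q : {poly int}) :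
    map_poly (ratr : rat -> F) (map_poly intr Q) = map_poly intr Q.
  by rewrite -map_poly_comp; apply: eq_map_poly => i /=; rewrite ratr_int.
have rootq y : y != 1 -> y ^+ p = 1 -> root (map_poly (ratr : rat -> F) q) y.
  by move=> ? ?; rewrite q_Phi toF root_Cyclotomic_prime.
pose PQ : {poly rat} := map_poly intr P.
have q_neq0 : q != 0.
  rewrite -(map_poly_eq0 (ratr : {rmorphism rat -> algC})) -qE.
  by rewrite monic_neq0 // minCpoly_monic.
have qP : q %| PQ.
  have := dvdp_gcdl PQ q; have := dvdp_gcdr PQ q.
  have : ~~ coprimep PQ q.
    apply/negP=> co; have := coprimep_map (ratr : {rmorphism rat -> F}) PQ q.
    rewrite co toF => /coprimep_root /(_ Pz); rewrite -rootE.
    exact/negP/negPn/rootq.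
  (* [w] is a root of one factor of [q = e * g], and by minimality [q] divides that factor. Degrees
     exclude [e], since [g] is not constant. *)
  rewrite coprimep_def; move: (gcdp PQ q) => g g_size /dvdpP[e qe] g_dvd.
  have : root (map_poly ratr q) w by rewrite q_min.
  rewrite {1}qe rmorphM /= rootM !q_min => /orP[q_e|]; last first.
    by move=> q_g; apply: dvdp_trans q_g g_dvd.
  have e_neq0 : e != 0 by apply: contra_neq q_neq0 => e0; rewrite qe e0 mul0r.
  have g_neq0 : g != 0 by apply: contra_neq q_neq0 => g0; rewrite qe g0 mulr0.
  have e_gt0 : (0 < size e)%N by rewrite size_poly_gt0.
  have g_gt0 : (0 < size g)%N by rewrite size_poly_gt0.
  have g_neq1 : size g <> 1%N by apply/eqP.
  have : ((size e + size g).-1 <= size e)%N.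
    by have := dvdp_leq e_neq0 q_e; rewrite {1}qe size_mul.
  move: (size e) (size g) e_gt0 g_gt0 g_neq1; clear; lia.
have /dvdpP[r] := qP.
move=> /(congr1 (map_poly (ratr : rat -> F))); rewrite toF rmorphM /= => ->.
rewrite rootM rootq ?orbT //; last by rewrite exprAC zp1 expr1n.
apply: contra_neq z_neq1 => za1.
have [|u _ /dvdnP[v uv]] := @Bezoutl a p; first by case: (a) co_ap => //;
  rewrite /coprime gcd0n => /eqP p1; rewrite p1 in p_pr.
have : z ^+ (gcdn a p + u * p) = 1 by rewrite uv mulnC exprM za1 expr1n.
by rewrite (eqP co_ap) exprS mulnC exprM zp1 expr1n mulr1.
Qed.

(** * The quadratic character and Gauss sums *)

Section QuadraticCharacter.
Variable p : nat.
Hypotheses (p_prime : prime p) (p_odd : odd p).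

(** The Legendre symbol, integer valued so that spectra can be compared in [int]. *)
Definition quad_char (t : 'F_p) : int :=
  if t == 0 then 0 else if t \in SQ p then 1 else -1.
Local Notation eta := quad_char.

Lemma Fp_generator :
  {w : 'F_p | p.-1.-primitive_root w &
     forall t, t != 0 -> exists k, t = w ^+ k}.
Proof.
have p1_gt0 : (0 < p.-1)%N by case: p p_prime => [|[]].
pose rs := [seq t <- enum 'F_p | t != 0].
have rs_size : size rs = p.-1.
  have := cardC1 (0 : 'F_p); rewrite card_Fp // => <-.
  by rewrite cardE /rs /enum_mem -filter_predI; congr size;
    apply: eq_filter => x; rewrite !inE andbT.
have expp (t : 'F_p) : t != 0 -> t ^+ p.-1 = 1.
  move=> t0; have := expf_card t; rewrite card_Fp // => tp.
  by apply: (mulfI t0); rewrite mulr1 -exprS prednK ?prime_gt0.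
have rs_root : all p.-1.-unity_root rs.
  apply/allP => t; rewrite mem_filter => /andP[t0 _].
  by apply/unity_rootP; exact: expp.
have /hasP/sig2W[w _ w_prim] : has p.-1.-primitive_root rs.
  apply: has_prim_root => //; last by rewrite rs_size.
  by rewrite filter_uniq ?enum_uniq.
by exists w => // t t0; have [i ->] := prim_rootP w_prim (expp t t0); exists i.
Qed.

(** Since p - 1 is even, the parity of an exponent of [w] is well defined, and the squares are the
    even powers. *)
Lemma quad_char_generator w k :
  p.-1.-primitive_root w -> (forall t, t != 0 -> exists k, t = w ^+ k) ->
  eta (w ^+ k) = (-1) ^+ k.
Proof.
move=> w_prim w_gen; rewrite /quad_char -signr_odd.
have w0 : w != 0.
  apply/negP => /eqP w0; have := prim_expr_order w_prim; rewrite w0 expr0n.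
  by case: (p.-1) (prim_order_gt0 w_prim) => // n _ /eqP; rewrite eq_sym oner_eq0.
rewrite (negPf (expf_neq0 k w0)) inE expf_neq0 //=.
have -> : [exists y, w ^+ k == y ^+ 2] = ~~ odd k.
  apply/existsP/idP => [[y /eqP wk]|ke]; last first.
    by exists (w ^+ k./2); rewrite -exprM muln2 halfK (negPf ke) subn0.
  have y0 : y != 0 by apply: contra_neq (expf_neq0 k w0) => y0;
    rewrite wk y0 expr0n.
  have [j yE] := w_gen y y0; move: wk; rewrite yE -exprM => /eqP.
  rewrite (eq_prim_root_expr w_prim) => /eqP /(congr1 odd).
  have p1_even : odd p.-1 = false by case: (p) p_odd p_prime => //= q /negPf.
  have odd_mod i : odd (i %% p.-1) = odd i.
    by rewrite [in RHS](divn_eq i p.-1) oddD oddM p1_even andbF.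
  by rewrite !odd_mod oddM andbF => ->.
by case: (odd k).
Qed.

Lemma quad_char0 : eta 0 = 0.
Proof. by rewrite /quad_char eqxx. Qed.

Lemma quad_char1 : eta 1 = 1.
Proof.
have [w w_prim w_gen] := Fp_generator.
by rewrite -(expr0 w) (quad_char_generator 0 w_prim w_gen).
Qed.

Lemma quad_charM s t : eta (s * t) = eta s * eta t.
Proof.
have [->|s0] := eqVneq s 0; first by rewrite mul0r quad_char0 mul0r.
have [->|t0] := eqVneq t 0; first by rewrite mulr0 quad_char0 mulr0.
have [w w_prim w_gen] := Fp_generator.
have [[i ->] [j ->]] := (w_gen s s0, w_gen t t0).
by rewrite -exprD !(quad_char_generator _ w_prim w_gen) exprD.
Qed.

Lemma quad_charX t k : eta (t ^+ k) = eta t ^+ k.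
Proof.
by elim: k => [|k IHk]; rewrite ?expr0 ?quad_char1 // !exprS quad_charM IHk.
Qed.

Lemma quad_char_sqr t : eta t ^+ 2 = (t != 0)%:R.
Proof. by rewrite /quad_char; case: (t == 0) => //; case: (t \in SQ p). Qed.

Lemma quad_charN1 : eta (- 1) = (-1) ^+ (p./2).
Proof.
have [w w_prim w_gen] := Fp_generator.
have p_gt2 : (2 < p)%N by have := prime_gt1 p_prime; move: p_odd; clear; lia.
suff -> : -1 = w ^+ p./2 by rewrite (quad_char_generator _ w_prim w_gen).
have : (w ^+ p./2 - 1) * (w ^+ p./2 + 1) = 0.
  rewrite -subr_sqr expr1n -exprM.
  have -> : (p./2 * 2 = p.-1)%N by move: p_odd; clear; lia.
  by rewrite prim_expr_order // subrr.
move/eqP; rewrite mulf_eq0 => /orP[|]; last by rewrite addr_eq0 => /eqP ->.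
rewrite subr_eq0 -(prim_order_dvd w_prim) => /dvdn_leq; move: p_gt2; clear; lia.
Qed.

Lemma sum_quad_char : \sum_t eta t = 0.
Proof.
have [w w_prim w_gen] := Fp_generator.
have w0 : w != 0.
  apply/negP => /eqP w0; have := prim_expr_order w_prim; rewrite w0 expr0n.
  by case: (p.-1) (prim_order_gt0 w_prim) => // n _ /eqP; rewrite eq_sym oner_eq0.
have etaw : eta w = -1 by rewrite -(expr1 w) (quad_char_generator _ w_prim w_gen).
have : \sum_t eta t = - \sum_t eta t.
  rewrite {1}(reindex_inj (mulfI w0)) -sumrN; apply: eq_bigr => t _.
  by rewrite quad_charM etaw mulN1r.
move: (\sum_t _) => x; lia.
Qed.

Lemma quad_charV t : eta t^-1 = eta t.
Proof.
have [->|t0] := eqVneq t 0; first by rewrite invr0.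
have : eta t * eta t^-1 = 1 by rewrite -quad_charM mulfV // quad_char1.
by rewrite /quad_char invr_eq0 (negPf t0); do 2!case: ifP.
Qed.
End QuadraticCharacter.

(** * Additive characters and Gauss sums *)

Section Characters.
Variables (p : nat) (C : numClosedFieldType) (z : C).
Hypotheses (p_prime : prime p) (p_odd : odd p) (z_neq1 : z != 1) (zp1 : z ^+ p = 1).

Definition add_char (t : 'F_p) : C := z ^+ nat_of_ord t.
Local Notation chi := add_char.

Lemma add_char0 : chi 0 = 1.
Proof. by []. Qed.

Lemma expr_mod_p k : z ^+ (k %% p) = z ^+ k.
Proof. by rewrite [in RHS](divn_eq k p) exprD mulnC exprM zp1 expr1n mul1r. Qed.

Lemma add_charD s t : chi (s + t) = chi s * chi t.
Proof.
rewrite /chi -exprD -[RHS]expr_mod_p /=.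
by congr (z ^+ (_ %% _)); rewrite Fp_cast.
Qed.

Lemma add_charM s t : chi (s * t) = chi t ^+ nat_of_ord s.
Proof.
rewrite /chi -exprM mulnC -[RHS]expr_mod_p /=.
by congr (z ^+ (_ %% _)); rewrite Fp_cast.
Qed.

Lemma add_char_neq0 t : chi t != 0.
Proof.
rewrite expf_neq0 //; apply: contra_eq_neq zp1 => ->.
by rewrite expr0n eqn0Ngt prime_gt0 // eq_sym oner_neq0.
Qed.

Lemma add_charN t : chi (- t) = (chi t)^-1.
Proof.
by apply: (mulIf (add_char_neq0 t)); rewrite -add_charD addNr mulVf ?add_char_neq0.
Qed.

Lemma add_char_exp_p t : chi t ^+ p = 1.
Proof. by rewrite /chi exprAC zp1 expr1n. Qed.

Lemma norm_add_char t : `|chi t| = 1.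
Proof.
apply/eqP; rewrite -(@eqrXn2 _ p) ?prime_gt0 //.
by rewrite -normrX add_char_exp_p normr1 expr1n.
Qed.

Lemma conj_add_char t : (chi t)^* = chi (- t).
Proof. by rewrite add_charN invC_norm ?norm_add_char// expr1n invr1 mul1r.
Qed.

Lemma add_char_eq1 t : (chi t == 1) = (t == 0).
Proof.
apply/eqP/eqP => [t1|->]; last by rewrite add_char0.
apply: contra_neq_eq z_neq1 => t0.
by have := add_charM (t^-1) t; rewrite t1 expr1n mulVf // => <-.
Qed.

Lemma sum_add_char b : \sum_t chi (b * t) = (p%:R *+ (b == 0)) :> C.
Proof.
have [->|b0] := eqVneq b 0.
  under eq_bigr do rewrite mul0r add_char0.
  by rewrite sumr_const card_Fp.
have : \sum_t chi (b * t) = chi b * \sum_t chi (b * t).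
  rewrite {1}(reindex_inj (addrI 1)) mulr_sumr; apply: eq_bigr => t _.
  by rewrite mulrDr mulr1 add_charD.
move/eqP; rewrite -subr_eq0 -{1}[X in X - _]mul1r -mulrBl mulf_eq0 subr_eq0.
by rewrite eq_sym add_char_eq1 (negPf b0) => /eqP.
Qed.

Local Notation eta := (@quad_char p).

Definition gauss_sum : C := \sum_(t : 'F_p) (eta t)%:~R * chi t.
Local Notation G := gauss_sum.

(* The sum of chi (b * t) over b != 0. *)
Definition zero_char (t : 'F_p) : int := p%:Z *+ (t == 0) - 1.

(** Puts psi_0 and G psi_1 into one family indexed by the parity of j. With a natural exponent, the
    factor eta(b)^n coming from a conjugation is a shift of j. *)
Definition twisted_sum (j : nat) (t : 'F_p) : C :=
  \sum_(b : 'F_p | b != 0) (eta b)%:~R ^+ j * chi (b * t).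

Lemma quad_char_odd_exp b j :
  b != 0 -> eta b ^+ j = if odd j then eta b else 1 :> int.
Proof.
move=> b0; rewrite -[in LHS](odd_double_half j) exprD -muln2 mulnC exprM.
by rewrite quad_char_sqr b0 expr1n mulr1; case: (odd j).
Qed.

Lemma twisted_gauss_sum t :
  \sum_(b : 'F_p) (eta b)%:~R * chi (b * t) = G * (eta t)%:~R.
Proof.
have [->|t0] := eqVneq t 0.
  under eq_bigr do rewrite mulr0 add_char0 mulr1.
  by rewrite quad_char0 mulr0 -rmorph_sum /= sum_quad_char.
rewrite (reindex_inj (mulIf (invr_neq0 t0))) /gauss_sum mulr_suml.
apply: eq_bigr => b _; rewrite mulfVK // quad_charM // quad_charV // rmorphM /=.
by rewrite mulrAC.
Qed.

Lemma twisted_sumE j t :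
  twisted_sum j t =
    if odd j then G * (eta t)%:~R else (zero_char t)%:~R.
Proof.
have -> : twisted_sum j t =
    \sum_(b : 'F_p | b != 0)
       (if odd j then (eta b)%:~R else 1) * chi (b * t).
  apply: eq_bigr => b b0; rewrite -rmorphXn /= quad_char_odd_exp //.
  by case: (odd j).
case: (odd j).
  rewrite -twisted_gauss_sum [RHS](bigD1 0) //= quad_char0 mul0r add0r.
  by [].
have := sum_add_char t; rewrite (bigD1 0) //= mulr0 add_char0 => /(canRL (addKr _)).
rewrite /zero_char rmorphB rmorphMn /= addrC => <-.
by apply: eq_bigr => b _; rewrite mul1r mulrC.
Qed.

(** G eta(t) is the sum over b of eta(b) chi(b t). After exchanging the sums, orthogonality keeps
    only b = -1, which contributes eta(-1) p. *)
Lemma gauss_sum_sqr : G ^+ 2 = ((-1) ^+ p./2 * p%:R).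
Proof.
rewrite expr2 {2}/gauss_sum mulr_sumr.
under eq_bigr => t _ do rewrite mulrA -twisted_gauss_sum mulr_suml.
rewrite exchange_big /= (bigD1 (-1)) //= [X in _ + X]big1 ?addr0; last first.
  move=> b b_neq; under eq_bigr => t _.
    rewrite -mulrA -add_charD -[X in _ + X]mul1r -mulrDl; over.
  by rewrite -mulr_sumr sum_add_char addr_eq0 (negPf b_neq) mulr0.
under eq_bigr => t _ do rewrite -mulrA -add_charD -[X in _ + X]mul1r -mulrDl.
by rewrite -mulr_sumr sum_add_char addNr eqxx mulr1n quad_charN1 // rmorphXn
  rmorphN1.
Qed.

Lemma root_intr_expr_Fp (P : {poly int}) (a : 'F_p) :
  a != 0 -> root (map_poly intr P) z -> root (map_poly intr P) (z ^+ nat_of_ord a).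
Proof.
move=> a0; apply: root_intr_expr_prime p_prime z_neq1 zp1 _.
rewrite coprime_sym prime_coprime // gtnNdvd ?lt0n //.
by apply: leq_trans (ltn_ord a) _; rewrite (Fp_cast p_prime) leqnn.
Qed.

Lemma horner_Xn_add_char (a t : 'F_p) :
  (map_poly (intr : int -> C) 'X^(nat_of_ord t)).[z ^+ nat_of_ord a] = chi (a * t).
Proof. by rewrite map_polyXn hornerXn add_charM exprAC. Qed.

(** The hypothesis says that an integer polynomial vanishes at z, hence also at z^a. The conjugation
    turns G into eta(a) G, whence the factor eta(a)^n. *)
Lemma sum_add_char_transfer (I : finType) (u : I -> 'F_p) (e : int) (n : nat)
    (t a : 'F_p) : a != 0 ->
  \sum_i chi (u i) = e%:~R * G ^+ n * chi t ->
  \sum_i chi (a * u i) = (e * eta a ^+ n)%:~R * G ^+ n * chi (a * t).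
Proof.
move=> a0.
pose P : {poly int} := \sum_i 'X^(nat_of_ord (u i)) -
  e%:P * (\sum_(s : 'F_p) (eta s)%:P * 'X^(nat_of_ord s)) ^+ n
    * 'X^(nat_of_ord t).
have PE (b : 'F_p) : (map_poly (intr : int -> C) P).[z ^+ nat_of_ord b] =
    \sum_i chi (b * u i) - (e * eta b ^+ n)%:~R * G ^+ n * chi (b * t).
  rewrite /P rmorphB !rmorphM rmorphXn !rmorph_sum !hornerE !horner_sum.
  congr (_ - _); first by apply: eq_bigr => i _; rewrite horner_Xn_add_char.
  rewrite /= horner_Xn_add_char map_polyC hornerC rmorphXn rmorph_sum /=.
  rewrite horner_exp horner_sum -!mulrA; congr (_ * _); rewrite mulrA;
    congr (_ * _).
  rewrite -exprMn mulrC -twisted_gauss_sum; congr (_ ^+ _); apply: eq_bigr => s _.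
  by rewrite rmorphM /= map_polyC hornerM hornerC horner_Xn_add_char [s * b]mulrC.
move=> uE; have := root_intr_expr_Fp (P := P) a0; rewrite !rootE PE.
have -> : z = z ^+ nat_of_ord (1 : 'F_p) by [].
rewrite PE quad_char1 // expr1n mulr1 mul1r; under eq_bigr do rewrite mul1r.
by rewrite uE subrr eqxx subr_eq0 => /(_ isT) /eqP.
Qed.

(** The squared modulus is itself a sum of characters, over pairs of indices, so the previous
    transfer applies with n = 0. *)
Lemma norm_sum_add_char_transfer (I : finType) (u : I -> 'F_p) (N : int)
    (a : 'F_p) : a != 0 ->
  `|\sum_i chi (u i)| ^+ 2 = N%:~R -> `|\sum_i chi (a * u i)| ^+ 2 = N%:~R.
Proof.
move=> a0.
have normE (b : 'F_p) : `|\sum_i chi (b * u i)| ^+ 2 =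
    \sum_(k : I * I) chi (b * (u k.1 - u k.2)).
  rewrite normCK rmorph_sum mulr_suml /=.
  under eq_bigr do rewrite mulr_sumr.
  rewrite pair_bigA; apply: eq_bigr => k _.
  by rewrite conj_add_char -add_charD mulrBr.
have := @sum_add_char_transfer _ (fun k : I * I => u k.1 - u k.2) N 0 0 a a0.
rewrite !expr0 !mulr1 mulr0 add_char0 mulr1 -normE => H uN; apply: H.
by rewrite -uN -[in RHS](eq_bigr _ (fun i _ =>
  congr1 chi (mul1r (u i)))) normE; apply: eq_bigr => k _; rewrite mul1r.
Qed.
End Characters.

(** * Fourier transform on 'rV['F_p]_n *)

Definition convol (R : numDomainType) (p n : nat)
    (phi psi : 'rV['F_p]_n -> R) (x : 'rV['F_p]_n) : R :=
  \sum_w phi (x - w) * psi w.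

Section Fourier.
Variables (p : nat) (C : numClosedFieldType) (z : C) (n : nat).
Hypotheses (p_prime : prime p) (p_odd : odd p) (z_neq1 : z != 1) (zp1 : z ^+ p = 1).
Local Notation V := 'rV['F_p]_n.
Local Notation chi := (@add_char p C z).

Lemma dotpC (x y : V) : dotp x y = dotp y x.
Proof. by apply: eq_bigr => i _; rewrite mulrC. Qed.

Lemma dotpDr (x y w : V) : dotp x (y + w) = dotp x y + dotp x w.
Proof. by rewrite -big_split; apply: eq_bigr => i _; rewrite mxE mulrDr. Qed.

Lemma dotpZr c (x y : V) : dotp x (c *: y) = c * dotp x y.
Proof. by rewrite mulr_sumr; apply: eq_bigr => i _; rewrite mxE mulrCA. Qed.

Lemma dotp0r (x : V) : dotp x 0 = 0.
Proof. by rewrite -(scale0r 0) dotpZr mul0r. Qed.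

Lemma dotpNr (x y : V) : dotp x (- y) = - dotp x y.
Proof. by rewrite -scaleN1r dotpZr mulN1r. Qed.

Lemma card_rV_Fp : #|{: V}| = (p ^ n)%N.
Proof. by rewrite card_mx card_Fp // mul1n. Qed.

Lemma sum_add_char_dotp (x : V) :
  \sum_a chi (dotp a x) = (p ^ n)%:R *+ (x == 0).
Proof.
have [->|x0] := eqVneq x 0.
  under eq_bigr do rewrite dotp0r add_char0.
  by rewrite sumr_const card_rV_Fp.
have [i xi0] : exists i, x 0 i != 0.
  have [i xi0|x_eq0] := pickP (fun i => x 0 i != 0); first by exists i.
  by case/eqP: x0; apply/rowP => i; rewrite mxE; apply/eqP/negbFE/x_eq0.
(* Translating by a vector [d] with dot product 1 against x multiplies the sum by chi(1), which is
   not 1. *)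
pose d : V := (x 0 i)^-1 *: delta_mx 0 i.
have dx : dotp d x = 1.
  rewrite /dotp (bigD1 i) //= big1 ?addr0 => [|j ji]; rewrite !mxE eqxx /=.
    by rewrite eqxx mulr1 mulVf.
  by rewrite (negPf ji) mulr0 mul0r.
have : \sum_a chi (dotp a x) = chi 1 * \sum_a chi (dotp a x).
  rewrite {1}(reindex_inj (addrI d)) mulr_sumr; apply: eq_bigr => a _.
  by rewrite dotpC dotpDr !(dotpC x) dx add_charD.
move/eqP; rewrite -subr_eq0 -{1}[X in X - _]mul1r -mulrBl mulf_eq0 subr_eq0.
by rewrite eq_sym add_char_eq1 // oner_eq0 => /eqP.
Qed.

Definition fourier (phi : V -> C) (a : V) : C :=
  \sum_x phi x * chi (- dotp a x).

Lemma eq_fourier phi psi : phi =1 psi -> fourier phi =1 fourier psi.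
Proof. by move=> e a; apply: eq_bigr => x _; rewrite e. Qed.

Lemma fourierD phi psi a :
  fourier (fun x => phi x + psi x) a = fourier phi a + fourier psi a.
Proof. by rewrite -big_split; apply: eq_bigr => x _; rewrite mulrDl. Qed.

Lemma fourierZ c phi a : fourier (fun x => c * phi x) a = c * fourier phi a.
Proof. by rewrite mulr_sumr; apply: eq_bigr => x _; rewrite mulrA. Qed.

Lemma fourier_delta a : fourier (fun x => (x == 0)%:R) a = 1.
Proof.
rewrite /fourier (bigD1 0) //= eqxx mul1r dotp0r oppr0 add_char0 big1 ?addr0 //.
by move=> x x0; rewrite (negPf x0) mul0r.
Qed.

Lemma fourier1 a : fourier (fun=> 1) a = (p ^ n)%:R *+ (a == 0).
Proof.
rewrite -oppr_eq0 -sum_add_char_dotp; apply: eq_bigr => x _.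
by rewrite mul1r dotpNr dotpC.
Qed.

Lemma fourier_at0 phi : fourier phi 0 = \sum_x phi x.
Proof.
by apply: eq_bigr => x _; rewrite dotpC dotp0r oppr0 add_char0 mulr1.
Qed.

Lemma fourierK phi x :
  fourier (fourier phi) (- x) = (p ^ n)%:R * phi x.
Proof.
rewrite /fourier; under eq_bigr => a _ do rewrite mulr_suml.
rewrite exchange_big (bigD1 x) //= [X in _ + X]big1 ?addr0 => [|y y_neq].
  under eq_bigr => a _.
    rewrite -mulrA -add_charD // [dotp _ a]dotpC dotpNr opprK addNr add_char0
      mulr1; over.
  by rewrite sumr_const card_rV_Fp mulr_natl.
under eq_bigr => a _.
  rewrite -mulrA -add_charD // [dotp _ a]dotpC -!dotpNr -dotpDr opprK; over.
by rewrite -mulr_sumr sum_add_char_dotp addrC subr_eq0 eq_sym (negPf y_neq) mulr0.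
Qed.

Lemma fourier_convol phi psi a :
  fourier (convol phi psi) a = fourier phi a * fourier psi a.
Proof.
rewrite /fourier /convol; under eq_bigr => x _ do rewrite mulr_suml.
rewrite exchange_big mulr_sumr; apply: eq_bigr => w _ /=.
rewrite (reindex_inj (addIr w)) mulr_suml; apply: eq_bigr => x _ /=.
by rewrite addrK dotpDr opprD add_charD // mulrACA.
Qed.
End Fourier.

(** * Homogeneous functions and conjugate Walsh coefficients *)

Section Homogeneous.
Variables (p : nat) (C : numClosedFieldType) (z : C) (n : nat).
Hypotheses (p_prime : prime p) (p_odd : odd p) (z_neq1 : z != 1) (zp1 : z ^+ p = 1).
Local Notation V := 'rV['F_p]_n.
Local Notation chi := (@add_char p C z).
Local Notation eta := (@quad_char p).
Local Notation G := (@gauss_sum p C z).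
Variables (f : V -> 'F_p) (k : nat).
Hypotheses (k_coprime : coprime k (p - 1))
  (f_homog : forall a x, a != 0 -> f (a *: x) = a ^+ k.+1 * f x).

(** [k] is coprime to the even number p - 1. It is one less than the degree of f, so the degree is
    even and f is an even function. *)
Lemma homog_degree_odd : odd k.
Proof.
have p1_even : (2 %| p - 1)%N by rewrite dvdn2 oddB ?prime_gt0 // p_odd.
move/(coprime_dvdr p1_even): k_coprime; by rewrite coprimen2.
Qed.

Lemma homog_even x : f (- x) = f x.
Proof.
rewrite -scaleN1r f_homog ?oppr_eq0 ?oner_eq0 //.
by rewrite -signr_odd /= homog_degree_odd mul1r.
Qed.

(** If a and b are nonzero with equal k-th powers, then a / b has k-th and (p - 1)-th powers equal
    to 1, and Bezout gives a = b. *)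
Lemma expf_coprime_inj : injective (fun a : 'F_p => a ^+ k).
Proof.
have k_gt0 : (0 < k)%N by move: homog_degree_odd; clear; lia.
move=> a b /= ab; have [b0|b0] := eqVneq b 0.
  by move: ab; rewrite b0 expr0n -[(k == 0)%N]negbK -lt0n k_gt0 => /eqP;
    rewrite expf_eq0 k_gt0 => /eqP.
have a0 : a != 0.
  by move: (expf_neq0 k b0); rewrite -ab expf_eq0 k_gt0.
have c0 : a / b != 0 by rewrite mulf_neq0 ?invr_eq0.
have ck : (a / b) ^+ k = 1 by rewrite expr_div_n ab mulfV // expf_neq0.
have cp : (a / b) ^+ (p - 1) = 1.
  apply: (mulfI c0); rewrite mulr1 -exprS -subSn ?prime_gt0 // subn1 /=.
  by have := expf_card (a / b); rewrite card_Fp.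
have [u _ /dvdnP[v uv]] := Bezoutl (p - 1) k_gt0.
have : (a / b) ^+ (gcdn k (p - 1) + u * (p - 1)) =
  1 by rewrite uv mulnC exprM ck expr1n.
rewrite (eqP k_coprime) exprS mulnC exprM cp expr1n mulr1 => /(canRL (mulfVK b0)).
by rewrite mul1r.
Qed.

Variables (g : V -> 'F_p) (eps : V -> int).
Hypothesis walshE : forall a,
  \sum_x chi (f x - dotp a x) = (eps a)%:~R * G ^+ n * chi (g a).

(* Substituting b = c ^ (- k) and x = c *: y turns b * f x into c * f y, so that
   each term is a Galois conjugate of the Walsh coefficient at a. *)
Lemma fourier_twisted_sum j a :
  fourier z (twisted_sum z j \o f) a =
    (eps a)%:~R * G ^+ n * twisted_sum z (j + n) (g a).
Proof.
pose tau (c : 'F_p) := (c ^+ k)^-1.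
have tau_inj : injective tau by move=> c d /invr_inj /expf_coprime_inj.
have tau_eq0 c : (tau c == 0) = (c == 0).
  rewrite invr_eq0 expf_eq0; case: k homog_degree_odd => //.
rewrite /fourier /twisted_sum /=.
under eq_bigr => x _ do rewrite mulr_suml.
rewrite exchange_big (reindex_inj tau_inj) /= mulr_sumr.
rewrite (eq_bigl (fun c => c != 0)) => [|c]; last by rewrite tau_eq0.
apply: eq_bigr => c c0.
under eq_bigr => x _ do rewrite -mulrA -add_charD //.
rewrite -mulr_sumr.
have -> : eta (tau c) = eta c.
  by rewrite quad_charV // quad_charX // quad_char_odd_exp // homog_degree_odd.
rewrite (reindex_inj (scalerI c0)) /=.
under eq_bigr => x _.
  rewrite f_homog // exprS -mulrA dotpZr mulrCA [tau c * _]mulrA mulVf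
    ?expf_neq0 // mul1r -mulrBr; over.
(* Conjugating by c contributes eta(c)^n, which moves the twist from j to j + n. *)
rewrite (sum_add_char_transfer p_prime p_odd z_neq1 zp1 c0 (walshE a)).
by rewrite rmorphM rmorphXn /= exprD; ring.
Qed.
End Homogeneous.

(** * Level sets of a bent function *)

Section LevelCounts.
Variables (p : nat) (C : numClosedFieldType) (z : C) (n : nat).
Hypotheses (p_prime : prime p) (p_odd : odd p) (z_neq1 : z != 1) (zp1 : z ^+ p = 1).
Hypothesis n_ge3 : (3 <= n)%N.
Local Notation V := 'rV['F_p]_n.
Local Notation chi := (@add_char p C z).
Local Notation eta := (@quad_char p).
Local Notation G := (@gauss_sum p C z).
Variable f : V -> 'F_p.
Hypothesis f_norm : `|\sum_x chi (f x)| ^+ 2 = (p ^ n)%:R.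

(** Triangle inequality over the p - 1 values of b: each inner sum is a conjugate of the sum of
    chi(f x), so its squared modulus is p^n. *)
Lemma sum_twisted_sum_le j :
  `|\sum_x twisted_sum z j (f x)| ^+ 2 <= ((p.-1) ^ 2 * p ^ n)%:R.
Proof.
set r : C := sqrtC (p ^ n)%:R.
have r_ge0 : 0 <= r by rewrite sqrtC_ge0 ler0n.
have rr : r ^+ 2 = (p ^ n)%:R by rewrite sqrtCK.
suff le_r : `|\sum_x twisted_sum z j (f x)| <= p.-1%:R * r.
  rewrite natrM natrX -rr -exprMn lerXn2r ?nnegrE // mulr_ge0 ?ler0n //.
rewrite /twisted_sum exchange_big /=.
apply: le_trans (ler_norm_sum _ _ _) _.
have card_nz : #|[pred b : 'F_p | b != 0]| = p.-1.
  by have := cardC1 (0 : 'F_p); rewrite card_Fp.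
rewrite -card_nz mulr_natl -sumr_const; apply: ler_sum => b b0.
rewrite -mulr_sumr normrM -rmorphXn /= quad_char_odd_exp //.
have -> : `|\sum_x chi (b * f x)| = r.
  apply/eqP; rewrite -(eqrXn2 (ltn0Sn 1)) // rr; apply/eqP.
  exact: (norm_sum_add_char_transfer (N := (p ^ n)%N%:Z)
    p_prime p_odd z_neq1 zp1 b0 f_norm).
have -> : `|(if odd j then eta b else 1)%:~R| = 1 :> C; last by rewrite mul1r.
by case: (odd j); rewrite ?normr1 // /quad_char (negPf b0); case: ifP;
  rewrite ?rmorphN ?normrN normr1.
Qed.

Lemma sum_zero_char_le :
  (\sum_x zero_char (f x)) ^+ 2 <= ((p.-1) ^ 2 * p ^ n)%:Z.
Proof.
have := sum_twisted_sum_le 0; under eq_bigr do rewrite twisted_sumE //=.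
rewrite -rmorph_sum -intr_norm -rmorphXn /= -[X in _ <= X]/(_%:Z%:~R).
by rewrite ler_int real_normK // num_real.
Qed.

Lemma sum_quad_char_le :
  p%:Z * (\sum_x eta (f x)) ^+ 2 <= ((p.-1) ^ 2 * p ^ n)%:Z.
Proof.
have := sum_twisted_sum_le 1; under eq_bigr do rewrite twisted_sumE //=.
rewrite -mulr_sumr -rmorph_sum normrM exprMn -normrX gauss_sum_sqr //.
rewrite normrM normrX normrN1 expr1n mul1r normr_nat -intr_norm -rmorphXn /=.
rewrite -[p%:R]/(p%:Z%:~R) -rmorphM /= -[X in _ <= X]/(_%:Z%:~R).
by rewrite ler_int real_normK // num_real.
Qed.

Lemma sum_pred_le1 (P : pred V) :
  (forall x, x != 0 -> ~~ P x) -> \sum_x ((P x)%:R : int) <= 1.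
Proof.
move=> P0; rewrite (bigD1 0) //= big1 => [|x /P0/negPf -> //].
by rewrite addr0; case: (P 0).
Qed.

(* By the two bounds above each level has at least two elements. *)
Lemma levels_nonempty :
  [/\ exists2 x, x != 0 & f x = 0,
      exists2 x, x != 0 & eta (f x) = 1 &
      exists2 x, x != 0 & eta (f x) = -1].
Proof.
have p_ge3 : 3%:Z <= p%:Z by have := prime_gt1 p_prime; move: p_odd; clear; lia.
pose q := (p ^ n.-1)%N%:Z.
have pnE : (p ^ n)%N%:Z = p%:Z * q.
  by rewrite -{1}(prednK (ltnW (ltnW n_ge3))) expnS PoszM.
have q_ge : p%:Z ^+ 2 <= q.
  rewrite expr2 -PoszM mulnn lez_nat leq_pexp2l ?prime_gt0 //.
  by move: n_ge3; clear; lia.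
pose N0 : int := \sum_x (f x == 0)%:R.
pose N1 : int := \sum_x (eta (f x) == 1)%:R.
pose N2 : int := \sum_x (eta (f x) == -1)%:R.
have S0 := sum_zero_char_le; have S1 := sum_quad_char_le.
have cardV : \sum_(x : V) 1 = p%:Z * q.
  by rewrite sumr_const card_rV_Fp // natz.
have S0E : \sum_x zero_char (f x) = p%:Z * N0 - p%:Z * q.
  rewrite /zero_char sumrB cardV mulr_sumr; congr (_ - _).
  by apply: eq_bigr => x _; rewrite mulr_natr.
have S1E : \sum_x eta (f x) = N1 - N2.
  rewrite -sumrB; apply: eq_bigr => x _; rewrite /quad_char.
  by case: (f x == 0) => //; case: (f x \in SQ p).
have NE : N0 + N1 + N2 = p%:Z * q.
  rewrite -cardV -!big_split; apply: eq_bigr => x _; rewrite /quad_char.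
  by case: (f x == 0) => //; case: (f x \in SQ p).
have [b0 b1] : `|p%:Z * N0 - p%:Z * q| <= (p%:Z - 1) * q /\
               p%:Z * `|N1 - N2| <= (p%:Z - 1) * q.
  have p1_ge0 : 0 <= p%:Z - 1 by move: p_ge3; clear; lia.
  (* From n >= 3, n + 1 <= 2 (n - 1), so p^(n+1) <= q^2. *)
  have le_pn : ((p.-1) ^ 2 * p ^ n)%N%:Z * p%:Z <= ((p%:Z - 1) * q) ^+ 2.
    have -> : p%:Z - 1 = p.-1%:Z by move: p_ge3; clear; lia.
    rewrite expr2 -!PoszM lez_nat -mulnA -expnSr mulnACA mulnn leq_mul2l -expnD.
    rewrite leq_pexp2l ?prime_gt0 ?orbT //; by move: n_ge3; clear; lia.
  split; rewrite -(@ler_pXn2r _ 2) ?nnegrE ?mulr_ge0 //.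
    rewrite real_normK ?num_real // -S0E; apply: le_trans S0 _.
    by apply: le_trans le_pn; rewrite ler_peMr //; move: p_ge3; clear; lia.
  rewrite exprMn real_normK ?num_real // -S1E expr2 -mulrA.
  by apply: le_trans le_pn; rewrite mulrC ler_pM2r //; move: p_ge3; clear; lia.
(* Two elements are asked for because one of them may be the origin. *)
have [N0_ge2 N1_ge2 N2_ge2] : [/\ 2 <= N0, 2 <= N1 & 2 <= N2].
  move: b0 b1 NE q_ge p_ge3; clear; move: p%:Z => P; split; nia.
split.
- have [x /andP[x0 /eqP fx]|none] := pickP (fun x => (x != 0) && (f x == 0));
  first by exists x.
  suff : N0 <= 1 by move: N0_ge2; clear; lia.
  by apply: sum_pred_le1 => x x0; have := none x; rewrite x0 /= => ->.
- have [x /andP[x0 /eqP fx]|none] := pickP (fun x =>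
  (x != 0) && (eta (f x) == 1)); first by exists x.
  suff : N1 <= 1 by move: N1_ge2; clear; lia.
  by apply: sum_pred_le1 => x x0; have := none x; rewrite x0 /= => ->.
have [x /andP[x0 /eqP fx]|none] := pickP (fun x =>
  (x != 0) && (eta (f x) == -1)); first by exists x.
suff : N2 <= 1 by move: N2_ge2; clear; lia.
by apply: sum_pred_le1 => x x0; have := none x; rewrite x0 /= => ->.
Qed.
End LevelCounts.

(** * Schemes and convolution *)

Lemma indexed_partition_fibers (T : finType) (d : nat) (A : 'I_d.+1 -> {set T})
    (c : T -> 'I_d.+1) :
  (forall i x, (x \in A i) = (c x == i)) -> (forall i, exists x, c x = i) ->
  Defs.indexed_partition A.
Proof.
move=> AE c_surj; split.
  move=> i j Aij; have [x cx] := c_surj i; apply/eqP.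
  by rewrite -cx -AE -Aij AE cx.
apply/and3P; split.
- rewrite eqEsubset subsetT; apply/subsetP => x _.
  by apply/bigcupP; exists (A (c x)); rewrite ?AE // imset_f.
- apply/trivIsetP => _ _ /imsetP[i _ ->] /imsetP[j _ ->] Aij.
  rewrite -setI_eq0; apply/set0Pn => -[x];
    rewrite inE !AE => /andP[/eqP ci /eqP cj].
  by case/eqP: Aij; rewrite -ci -cj.
apply/imsetP => -[i _ A0]; have [x cx] := c_surj i.
by have := AE i x; rewrite -A0 inE cx eqxx.
Qed.

Section TranslationScheme.
Variables (p : nat) (F : numDomainType) (n d : nat).
Local Notation V := 'rV['F_p]_n.
Variables (P : d.+1.-tuple {set V}) (cl : V -> 'I_d.+1).
Hypotheses (PE : forall i x, (x \in tnth P i) = (cl x == i))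
  (cl_surj : forall i, exists x, cl x = i)
  (cl_eq0 : forall x, (cl x == ord0) = (x == 0))
  (clN : forall x, cl (- x) = cl x).

(** Intersection numbers are values of convolutions of class indicators, and convolution is
    bilinear. Integers embed in [F], so counts are recovered whatever [F] is. *)
Lemma induces_sym_scheme_convol :
  induces_sym_scheme P <->
  forall phi psi : 'I_d.+1 -> F, exists theta : 'I_d.+1 -> F,
    forall x, convol (phi \o cl) (psi \o cl) x = theta (cl x).
Proof.
split=> [[_ _ [[_ _ _ _ inter] _]] phi psi|convol_cl].
  pose K u v x := #|[set w : V | (cl (x - w) == u) && (cl w == v)]|.
  have /fin_all_exists[c cE] (w : 'I_d.+1) : exists c : 'I_d.+1 * 'I_d.+1 -> nat,
      forall uv x, cl x = w -> K uv.1 uv.2 x = c uv.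
    suff /fin_all_exists[c cE] : forall uv : 'I_d.+1 * 'I_d.+1, exists c,
        forall x, cl x = w -> K uv.1 uv.2 x = c by exists c.
    move=> [u v] /=; have [c cE] := inter u v w.
    exists c => x xw; rewrite -(cE x 0); last by rewrite inE PE subr0 xw.
    by apply: eq_card => w'; rewrite !inE !PE subr0.
  exists (fun w => \sum_uv phi uv.1 * psi uv.2 * (c w uv)%:R) => x.
  rewrite /convol.
  (* Split by the classes of x - w and w: the summand is constant on each part, whose size is an
     intersection number. *)
  rewrite (partition_big (fun w => (cl (x - w), cl w)) xpredT) //=.
  apply: eq_bigr => -[u v] _ /=; rewrite -(cE _ (u, v) x erefl) /=.
  rewrite (eq_bigr (fun=> phi u * psi v)) => [|w /eqP[<- <-]] //.
  rewrite sumr_const mulr_natr; congr (_ *+ _); apply: eq_card => w.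
  by rewrite inE unfold_in.
pose E i := [set u : V * V | u.1 - u.2 \in tnth P i].
have EE i u : (u \in E i) = (cl (u.1 - u.2) == i) by rewrite inE PE.
have cl0 : cl 0 = ord0 by apply/eqP; rewrite cl_eq0.
have symE j : transp (E j) = E j.
  by apply/setP => u; rewrite inE !EE /= -(opprB u.1 u.2) clN.
split; first exact: indexed_partition_fibers PE cl_surj.
  by apply/setP => x; rewrite PE cl_eq0 inE.
split=> //; split.
- by rewrite -cardsT; apply/card_gt0P; exists 0.
- apply: (indexed_partition_fibers EE) => i; have [x xi] := cl_surj i.
  by exists (x, 0); rewrite subr0.
- by apply/setP => u; rewrite EE cl_eq0 subr_eq0 inE.
- by move=> j; exists j; exact: symE.
move=> u v w.
have [theta thetaE] := convol_cl (fun i => (i == u)%:R) (fun i => (i == v)%:R).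
have cardE x y : (x, y) \in E w ->
    #|[set t | ((x, t) \in E u) && ((t, y) \in E v)]|%:R = theta w.
  rewrite EE /= => /eqP <-; rewrite -thetaE /convol -sum1_card natr_sum.
  (* Translation by y turns the count for the pair (x, y) into the convolution at x - y. *)
  rewrite (reindex_inj (addIr y)) big_mkcond; apply: eq_bigr => t _ /=.
  rewrite !inE !PE /= addrK opprD addrA addrAC -natrM mulnb; by case: andP.
have [a aw] := cl_surj w.
exists #|[set t | ((a, t) \in E u) && ((t, 0) \in E v)]| => x y xy.
have := cardE _ _ xy; rewrite -(cardE a 0) => [/eqP|]; last by rewrite EE subr0 aw.
by rewrite eqr_nat => /eqP.
Qed.
End TranslationScheme.

(** For f with f 0 = 0, these are the functions constant on the classes of U ([with_eta] true) or V
    (false), written in a family with known Fourier transforms. The c0 term frees the origin, as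
    needed for the dual, whose value at 0 is not prescribed. *)
Definition in_class_span (F : numFieldType) (p n : nat) (with_eta : bool)
    (f : 'rV['F_p]_n -> 'F_p) (phi : 'rV['F_p]_n -> F) : Prop :=
  exists c0 c1 c2 c3 : F, (~~ with_eta -> c3 = 0) /\
    forall x, phi x = c0 * (x == 0)%:R + c1 + c2 * (zero_char (f x))%:~R
                      + c3 * (quad_char (f x))%:~R.

Section Partitions.
Variables (p n : nat) (f : 'rV['F_p]_n -> 'F_p).
Hypotheses (p_prime : prime p) (f0 : f 0 = 0).
Hypothesis f_homog_even : forall x, f (- x) = f x.
Hypothesis f_levels : [/\ exists2 x, x != 0 & f x = 0,
  exists2 x, x != 0 & quad_char (f x) = 1 &
  exists2 x, x != 0 & quad_char (f x) = -1].
Local Notation V := 'rV['F_p]_n.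

Definition classU (x : V) : 'I_4 :=
  if x == 0 then @Ordinal 4 0 isT else
  if f x == 0 then @Ordinal 4 1 isT else
  if f x \in SQ p then @Ordinal 4 2 isT else @Ordinal 4 3 isT.

Definition classV (x : V) : 'I_3 :=
  if x == 0 then @Ordinal 3 0 isT else
  if f x == 0 then @Ordinal 3 1 isT else @Ordinal 3 2 isT.

Lemma mem_bigcup_levelset (A : {set 'F_p}) x :
  (x \in \bigcup_(i in A) levelset f i) = (f x \in A).
Proof.
apply/bigcupP/idP => [[i iA]|fA]; first by rewrite inE => /eqP ->.
by exists (f x); rewrite ?inE.
Qed.

Lemma mem_partU i x : (x \in tnth (partU f) i) = (classU x == i).
Proof.
have NSQE t : (t \in NSQ p) = (t != 0) && (t \notin SQ p) by rewrite !inE;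
  case: eqP.
have SQ0 : (0 \in SQ p) = false by rewrite inE eqxx.
case: i => [[|[|[|[|//]]]] i_lt];
  rewrite /tnth /= ?mem_bigcup_levelset ?NSQE /classU.
- rewrite in_set1; case: (x == 0) => //; case: (f x == 0) => //.
  by case: (f x \in SQ p).
- rewrite in_setD1 inE; case: (x == 0) => //; case: (f x == 0) => //=.
  by case: ifP.
- have [->|x0] := eqVneq x 0; first by rewrite f0 SQ0.
  have [->|fx0] := eqVneq (f x) 0; first by rewrite SQ0.
  by case: (f x \in SQ p).
have [->|x0] := eqVneq x 0; first by rewrite f0 eqxx.
by case: (f x == 0) => //; case: (f x \in SQ p).
Qed.

Lemma mem_partV i x : (x \in tnth (partV f) i) = (classV x == i).
Proof.
case: i => [[|[|[|//]]] i_lt]; rewrite /tnth /= ?mem_bigcup_levelset ?inE /classV.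
- by case: (x == 0) => //; case: (f x == 0).
- by case: (x == 0) => //; case: (f x == 0).
by have [->|x0] := eqVneq x 0; rewrite ?f0 ?eqxx //; case: (f x == 0).
Qed.

Lemma quad_char_SQ t : quad_char t = 1 -> (t != 0) && (t \in SQ p).
Proof. by rewrite /quad_char; case: (t == 0); case: (t \in SQ p). Qed.

Lemma quad_char_NSQ t : quad_char t = -1 -> (t != 0) && (t \notin SQ p).
Proof. by rewrite /quad_char; case: (t == 0); case: (t \in SQ p). Qed.

Variable F : numFieldType.

Lemma in_class_span_U (phi : 'I_4 -> F) : in_class_span true f (phi \o classU).
Proof.
have p0 : p%:R != 0 :> F by rewrite pnatr_eq0 -lt0n prime_gt0.
pose P i := phi (@inord 3 i).
have Pi i (i_lt : (i < 4)%N) : phi (Ordinal i_lt) = P i.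
  by congr phi; apply: val_inj; rewrite /= inordK.
pose h := (P 2%N + P 3%N) / 2.
(* psi_0 is p - 1 on the zero level and -1 elsewhere, psi_1 separates squares from nonsquares around
   their mean h, and c0 corrects the origin. *)
exists (P 0%N - P 1%N), (h + (P 1%N - h) / p%:R), ((P 1%N - h)
  / p%:R), ((P 2%N - P 3%N) / 2).
split=> // x; rewrite /= /classU /zero_char /quad_char.
have [->|x0] := eqVneq x 0.
  rewrite f0 eqxx Pi rmorphB rmorphMn /= mulr1n -[p%:~R]/(p%:R); by field.
have [fx|fx0] := eqVneq (f x) 0.
  rewrite Pi rmorphB /= -[(p%:Z *+ true)%:~R]/(p%:R); by field.
by case: (f x \in SQ p); rewrite Pi rmorphB /=; rewrite /h; field.
Qed.

Lemma class_span_U (phi : V -> F) :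
  in_class_span true f phi -> exists theta : 'I_4 -> F, phi =1 theta \o classU.
Proof.
case=> c0 [c1 [c2 [c3 [_ phiE]]]].
(* [i < 2] includes the class of the origin because f 0 = 0. *)
exists (fun i : 'I_4 => c0 * (i == ord0)%:R + c1
   + c2 * (p%:Z *+ (i < 2)%N - 1)%:~R
   + c3 * (((i == 2 :> nat)%N%:R - (i == 3 :> nat)%N%:R) : int)%:~R) => x.
rewrite phiE /= /classU /zero_char /quad_char.
have [->|x0] := eqVneq x 0; first by rewrite f0 eqxx.
have [fx|fx0] //= := eqVneq (f x) 0.
by case: (f x \in SQ p).
Qed.

Lemma in_class_span_V (phi : 'I_3 -> F) : in_class_span false f (phi \o classV).
Proof.
have p0 : p%:R != 0 :> F by rewrite pnatr_eq0 -lt0n prime_gt0.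
pose P i := phi (@inord 2 i).
have Pi i (i_lt : (i < 3)%N) : phi (Ordinal i_lt) = P i.
  by congr phi; apply: val_inj; rewrite /= inordK.
exists (P 0%N - P 1%N), (P 2%N + (P 1%N - P 2%N) / p%:R), ((P 1%N - P 2%N)
  / p%:R), 0.
split=> // x; rewrite /= /classV /zero_char.
have [->|x0] := eqVneq x 0.
  rewrite f0 eqxx Pi rmorphB rmorphMn /= mulr1n -[p%:~R]/(p%:R); by field.
have [fx|fx0] := eqVneq (f x) 0.
  rewrite Pi rmorphB /= -[(p%:Z *+ true)%:~R]/(p%:R); by field.
by rewrite Pi rmorphB /=; field.
Qed.

Lemma class_span_V (phi : V -> F) :
  in_class_span false f phi -> exists theta : 'I_3 -> F, phi =1 theta \o classV.
Proof.
case=> c0 [c1 [c2 [c3 [c3_0 phiE]]]].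
exists (fun i : 'I_3 => c0 * (i == ord0)%:R + c1
   + c2 * (p%:Z *+ (i < 2)%N - 1)%:~R) => x.
rewrite phiE c3_0 // mul0r addr0 /= /classV /zero_char.
have [->|x0] := eqVneq x 0; first by rewrite f0 eqxx.
by have [fx|fx0] //= := eqVneq (f x) 0.
Qed.

Lemma induces_partU :
  induces_sym_scheme (partU f) <->
  forall phi psi : V -> F, in_class_span true f phi -> in_class_span true f psi ->
    in_class_span true f (convol phi psi).
Proof.
rewrite (induces_sym_scheme_convol F mem_partU); first last.
- by move=> x; rewrite /classU oppr_eq0 f_homog_even.
- move=> x; rewrite /classU; case: (x == 0) => //; case: (f x == 0) => //.
  by case: (f x \in SQ p).
- have [[x x0 fx] [y y0 /quad_char_SQ/andP[fy0 fy]]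
  [w w0 /quad_char_NSQ/andP[fw0 fw]]] := f_levels.
  case=> [[|[|[|[|//]]]] i_lt].
  + by exists 0; apply: val_inj; rewrite /classU eqxx.
  + by exists x; apply: val_inj; rewrite /classU (negPf x0) fx eqxx.
  + by exists y; apply: val_inj; rewrite /classU (negPf y0) (negPf fy0) fy.
  by exists w; apply: val_inj; rewrite /classU (negPf w0) (negPf fw0) (negPf fw).
split=> convol_cl.
  move=> phi psi /class_span_U[t tE] /class_span_U[t' t'E].
  have [th thE] := convol_cl t t'.
  have [c0 [c1 [c2 [c3 [c3_0 cE]]]]] := in_class_span_U th.
  exists c0, c1, c2, c3; split=> // x; rewrite -cE /= -thE.
  by apply: eq_bigr => w _; rewrite tE t'E.
move=> phi psi; have [th thE] := class_span_U (convol_cl _ _ (in_class_span_U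
  phi) (in_class_span_U psi)).
by exists th => x; rewrite thE.
Qed.

Lemma induces_partV :
  induces_sym_scheme (partV f) <->
  forall phi psi : V -> F, in_class_span false f phi -> in_class_span false f psi ->
    in_class_span false f (convol phi psi).
Proof.
rewrite (induces_sym_scheme_convol F mem_partV); first last.
- by move=> x; rewrite /classV oppr_eq0 f_homog_even.
- by move=> x; rewrite /classV; case: (x == 0) => //; case: (f x == 0).
- have [[x x0 fx] [y y0 /quad_char_SQ/andP[fy0 fy]] _] := f_levels.
  case=> [[|[|[|//]]] i_lt].
  + by exists 0; apply: val_inj; rewrite /classV eqxx.
  + by exists x; apply: val_inj; rewrite /classV (negPf x0) fx eqxx.
  by exists y; apply: val_inj; rewrite /classV (negPf y0) (negPf fy0).
split=> convol_cl.
  move=> phi psi /class_span_V[t tE] /class_span_V[t' t'E].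
  have [th thE] := convol_cl t t'.
  have [c0 [c1 [c2 [c3 [c3_0 cE]]]]] := in_class_span_V th.
  exists c0, c1, c2, c3; split=> // x; rewrite -cE /= -thE.
  by apply: eq_bigr => w _; rewrite tE t'E.
move=> phi psi; have [th thE] := class_span_V (convol_cl _ _ (in_class_span_V
  phi) (in_class_span_V psi)).
by exists th => x; rewrite thE.
Qed.
End Partitions.

(** * Spectra of the class functions *)

Lemma convol_intr (F : numDomainType) (p n : nat) (u v : 'rV['F_p]_n -> int) x :
  convol (intr \o u) (intr \o v) x = (convol u v x)%:~R :> F.
Proof. by rewrite rmorph_sum; apply: eq_bigr => w _; rewrite rmorphM. Qed.

Section Spectrum.
Variables (p n : nat) (C : numClosedFieldType) (z : C).
Hypotheses (p_prime : prime p) (p_odd : odd p) (z_neq1 : z != 1) (zp1 : z ^+ p = 1).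
Local Notation V := 'rV['F_p]_n.
Local Notation chi := (@add_char p C z).
Local Notation eta := (@quad_char p).
Local Notation G := (@gauss_sum p C z).

(* Both sides are U^2 - r U - t, a multiple of the indicator of 0, transformed back. *)
Lemma quadratic_spectrum (u U : V -> int) (r t : int) :
  (forall a, fourier z (intr \o u) a = (U a)%:~R) ->
  (forall a, a != 0 -> U a ^+ 2 = r * U a + t) ->
  forall x, (p ^ n)%:Z * (convol u u x - r * u x - t * (x == 0)%:R) =
    U 0 ^+ 2 - r * U 0 - t.
Proof.
move=> uE U_quad x; apply: (@intr_inj C).
pose phi (x : V) : C := convol (intr \o u) (intr \o u) x
  + ((- r)%:~R * (u x)%:~R + (- t)%:~R * (x == 0)%:R).
have phiE a : fourier z phi a = (U 0 ^+ 2 - r * U 0 - t)%:~R * (a == 0)%:R.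
  rewrite !fourierD !fourierZ fourier_convol // fourier_delta // uE.
  have [->|a0] := eqVneq a 0; first by rewrite !(rmorphB, rmorphD, rmorphM,
    rmorphN, rmorphXn) /=; ring.
  rewrite -expr2 -rmorphXn /= U_quad //.
  by rewrite !(rmorphB, rmorphD, rmorphM, rmorphN) /=; ring.
have := fourierK p_prime z_neq1 zp1 phi x.
rewrite (eq_fourier z phiE) fourierZ fourier_delta // mulr1 => ->.
rewrite /phi convol_intr rmorphM /= !(rmorphB, rmorphM, rmorphN) /=.
congr (_ * _); rewrite -[(x == 0)%:R%:~R]/((x == 0)%:R%:~R).
by case: (x == 0); rewrite /=; ring.
Qed.

(** This is G^2, often written p*. *)
Definition signed_prime : int := (-1) ^+ p./2 * p%:Z.
Local Notation ps := signed_prime.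

Lemma gauss_sum_even k : G ^+ k.*2 = (ps ^+ k)%:~R.
Proof.
by rewrite -muln2 mulnC exprM gauss_sum_sqr // rmorphXn rmorphM rmorphXn rmorphN1.
Qed.

Lemma signed_prime_sqr : ps ^+ 2 = p%:Z ^+ 2.
Proof. by rewrite exprMn exprAC sqrrN expr1n mul1r. Qed.

Lemma gauss_sum_neq0 : G != 0.
Proof.
have : G ^+ 2 != 0.
  rewrite (gauss_sum_even 1) expr1 intr_eq0 mulf_eq0 signr_eq0 /=.
  by rewrite -lt0n prime_gt0.
by rewrite expf_eq0.
Qed.

(** This is psi_b; with a boolean index the exchange for odd n is an exclusive or. *)
Definition class_char (b : bool) (t : 'F_p) : int :=
  if b then eta t else zero_char t.

Variables (f g : V -> 'F_p) (k : nat) (eps : V -> int).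
Hypotheses (k_coprime : coprime k (p - 1))
  (f_homog : forall a x, a != 0 -> f (a *: x) = a ^+ k.+1 * f x)
  (f0 : f 0 = 0).
Hypothesis walshE : forall a,
  \sum_x chi (f x - dotp a x) = (eps a)%:~R * G ^+ n * chi (g a).

Let twisted_to_class (b : bool) (h : V -> 'F_p) x :
  twisted_sum z b (h x) = G ^+ b * (class_char b (h x))%:~R.
Proof. by rewrite twisted_sumE //; case: b; rewrite ?expr0 ?mul1r. Qed.

(** Cancelling G^b from the transform of [twisted_sum] leaves G to the power n + (odd n (+) b) - b.
    This exponent is even, so the spectrum is integral. *)
Lemma fourier_class_char (b : bool) a :
  fourier z (intr \o class_char b \o f) a =
    (ps ^+ (n./2 + (odd n && ~~ b)) * eps a * class_char (odd n (+) b) (g a))%:~R.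
Proof.
have := fourier_twisted_sum p_prime p_odd z_neq1 zp1 k_coprime f_homog walshE b a.
rewrite (eq_fourier z (twisted_to_class b f)).
rewrite fourierZ => H; apply: (mulfI (expf_neq0 b gauss_sum_neq0)); rewrite {}H.
have -> : twisted_sum z (b + n) (g a) = twisted_sum z (odd n (+) b) (g a).
  by rewrite !twisted_sumE // oddD addbC; case: b; case: (odd n).
rewrite twisted_to_class -[in G ^+ n](odd_double_half n) exprD gauss_sum_even.
rewrite !rmorphM /= exprD rmorphM /=; case: b; case: (odd n);
  rewrite /= ?expr0 ?expr1 ?rmorph1; try by ring.
have := gauss_sum_even 1; rewrite expr1 => <-; ring.
Qed.

Hypothesis eps_sign : forall a, eps a ^+ 2 = 1.
Hypotheses (n_ge3 : (3 <= n)%N).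
Hypothesis f_levels : [/\ exists2 x, x != 0 & f x = 0,
  exists2 x, x != 0 & eta (f x) = 1 &
  exists2 x, x != 0 & eta (f x) = -1].
Hypothesis g_levels : [/\ exists2 x, x != 0 & g x = 0,
  exists2 x, x != 0 & eta (g x) = 1 &
  exists2 x, x != 0 & eta (g x) = -1].

Let A a := eps a * zero_char (g a).
Let B a := eps a * eta (g a).

Lemma fourier_A a : fourier z (intr \o class_char (odd n) \o f) a =
  (ps ^+ n./2 * A a)%:~R.
Proof. by rewrite fourier_class_char addbb andbN addn0 mulrA. Qed.

Lemma fourier_B a :
  fourier z (intr \o class_char (~~ odd n) \o f) a =
    (ps ^+ (n./2 + odd n) * B a)%:~R.
Proof. by rewrite fourier_class_char addbN addbb negbK andbb mulrA. Qed.

Let f_even x : f (- x) = f x := homog_even p_prime p_odd k_coprime f_homog x.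

Lemma zero_char_sqr (t : 'F_p) : zero_char t ^+ 2 =
  (p%:Z - 2) * zero_char t + (p%:Z - 1).
Proof. by rewrite /zero_char; case: (t == 0); rewrite ?mulr1n ?mulr0n; ring. Qed.

Lemma sum_sqr_zero_char (h : V -> 'F_p) :
  \sum_x zero_char (h x) ^+ 2 =
    (p%:Z - 2) * \sum_x zero_char (h x) + (p%:Z - 1) * (p ^ n)%N%:Z.
Proof.
have -> : (p ^ n)%N%:Z = \sum_(x : V) 1 by rewrite sumr_const card_rV_Fp // natz.
rewrite !mulr_sumr -big_split; apply: eq_bigr => x _.
by rewrite zero_char_sqr mulr1.
Qed.

(** Sum 2 u v <= u^2 + v^2 over w; both sums of squares equal the value at 0 because u is even. *)
Lemma convol_self_le (u : V -> int) x :
  (forall w, u (- w) = u w) -> convol u u x <= convol u u 0.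
Proof.
move=> u_even.
have c0E : convol u u 0 = \sum_w u w ^+ 2.
  by apply: eq_bigr => w _; rewrite sub0r u_even.
have c0E' : convol u u 0 = \sum_w u (x - w) ^+ 2.
  rewrite c0E (reindex_inj (inv_inj (subKr x))) /=; exact: eq_bigr.
have : 2 * convol u u x <= \sum_w u (x - w) ^+ 2 + \sum_w u w ^+ 2.
  rewrite -big_split mulr_sumr; apply: ler_sum => w _ /=.
  by have := sqr_ge0 (u (x - w) - u w); rewrite sqrrB; lia.
by rewrite -c0E' -c0E; lia.
Qed.

Let ps_neq0 : ps != 0.
Proof. by rewrite mulf_eq0 signr_eq0 /= -lt0n prime_gt0. Qed.

Let p_ge3 : 3%:Z <= p%:Z.
Proof. by have := prime_gt1 p_prime; move: p_odd; clear; lia. Qed.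

Let pn_neq0 : (p ^ n)%N%:Z != 0.
Proof. by rewrite -lt0n expn_gt0 prime_gt0. Qed.

Let convol_le b x : convol (class_char b \o f) (class_char b \o f) x <=
   convol (class_char b \o f) (class_char b \o f) 0.
Proof. by apply: convol_self_le => w /=; rewrite f_even. Qed.

Lemma sign_pm1 (e : int) : e ^+ 2 = 1 -> e = 1 \/ e = -1.
Proof. by move/eqP; rewrite sqrf_eq1 => /orP[]/eqP; [left|right]. Qed.

(* At a nonzero x with f x = 0 the autocorrelation would exceed its value at 0. *)
Lemma no_quadratic_A e :
  e ^+ 2 = 1 -> ~ forall a, a != 0 -> A a ^+ 2 = e * p%:Z * A a - (p%:Z - 1).
Proof.
move=> e2 A_quad; have [[x x0 fx] _ _] := f_levels.
set K := ps ^+ n./2; pose u := class_char (odd n) \o f.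
have K_gt0 : 0 < K ^+ 2 by rewrite exprn_even_gt0 //= expf_neq0.
have Q := quadratic_spectrum (u := u) (U := fun a => K * A a)
  (r := e * p%:Z * K) (t := - ((p%:Z - 1) * K ^+ 2)) fourier_A.
have {}Q := Q (fun a a0 => ltac:(rewrite exprMn A_quad //; ring)).
have := etrans (Q x) (esym (Q 0)); rewrite eqxx (negPf x0) => /(mulfI pn_neq0).
have -> : u x = u 0 by rewrite /u /= fx f0.
have := convol_le (odd n) x; rewrite -/u.
have : 0 < (p%:Z - 1) * K ^+ 2 by rewrite mulr_gt0 //; move: p_ge3; clear; lia.
by clear; lia.
Qed.

(* For n even, the autocorrelation would exceed its value at 0 on the squares or on
   the nonsquares; for n odd, evaluating at 0 gives an impossible size for the zero
   level of f. *)
Lemma no_quadratic_B e : e ^+ 2 = 1 -> ~ forall a, a != 0 -> B a ^+ 2 = e * B a.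
Proof.
move=> e2 B_quad.
set K := ps ^+ (n./2 + odd n); pose u := class_char (~~ odd n) \o f.
have K_neq0 : K != 0 by rewrite expf_neq0.
have Q := quadratic_spectrum (u := u) (U := fun a => K * B a)
  (r := e * K) (t := 0) fourier_B.
have {}Q := Q (fun a a0 => ltac:(rewrite exprMn B_quad //; ring)).
have [n_odd|n_even] := boolP (odd n); last first.
  have [_ [x x0 fx] [y y0 fy]] := f_levels.
  have ux : u x = 1 by rewrite /u n_even /= fx.
  have uy : u y = -1 by rewrite /u n_even /= fy.
  have u0 : u 0 = 0 by rewrite /u n_even /= f0 quad_char0.
  have := etrans (Q x) (esym (Q 0)); have := etrans (Q y) (esym (Q 0)).
  rewrite !mul0r !subr0 => /(mulfI pn_neq0) + /(mulfI pn_neq0).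
  have := convol_le (~~ odd n) x; have := convol_le (~~ odd n) y;
    rewrite -/u ux uy u0.
  have : e * K != 0.
    by rewrite mulf_neq0 //; apply: contra_eq_neq e2 => ->.
  by clear; lia.
(* For n odd, u is psi_0 o f, and its transform at 0 evaluates the sum S. *)
pose S := \sum_x u x.
have SE : S = K * B 0.
  apply: (@intr_inj C); rewrite -fourier_B fourier_at0 rmorph_sum; exact: eq_bigr.
have := Q 0; rewrite -SE mul0r !subr0.
have -> : u 0 = p%:Z - 1 by rewrite /u n_odd /= f0 /zero_char eqxx.
have -> : convol u u 0 = (p%:Z - 2) * S + (p%:Z - 1) * (p ^ n)%N%:Z.
  rewrite /S (eq_bigr (fun x => zero_char (f x))) => [|x _];
    last by rewrite /u n_odd.
  rewrite -sum_sqr_zero_char; apply: eq_bigr => w _.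
  by rewrite sub0r /u n_odd /= f_even.
pose q : int := p%:Z ^+ n./2.
have pnE : (p ^ n)%N%:Z = p%:Z * q ^+ 2.
  rewrite -{1}(odd_double_half n) n_odd expnS PoszM -muln2 expnM.
  by rewrite /q -!natz !natrX.
have KE : K = p%:Z * q \/ K = - (p%:Z * q).
  rewrite /K n_odd addn1 /signed_prime exprMn -exprM -signr_odd [p%:Z ^+ _]exprS.
  by case: (odd _) => /=; [right|left]; rewrite ?mulN1r ?mul1r.
have q_ge3 : 3 <= q.
  rewrite /q; have : (0 < n./2)%N by move: n_ge3; clear; lia.
  case: (n./2) => // m _; rewrite exprS.
  apply: le_trans p_ge3 _; rewrite ler_peMr // exprn_ege1 //.
  by move: p_ge3; clear; lia.
have BE : [\/ B 0 = 0, B 0 = 1 | B 0 = -1].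
  rewrite /B /quad_char; case: (sign_pm1 (eps_sign 0)) => ->;
    by case: (g 0 == 0); case: (g 0 \in SQ p); constructor.
rewrite pnE SE.
have eE := sign_pm1 e2.
have [t t_pm KE'] : exists2 t : int, t = 1 \/ t = -1 & K = t * (p%:Z * q).
  by case: KE => ->; [exists 1|exists (-1)]; rewrite ?mul1r ?mulN1r; auto.
rewrite {}KE'; move: BE eE t_pm q_ge3 p_ge3; clearbody q; clear KE pnE;
  move: (B 0) (p%:Z) q.
clear => b P q BE eE t_pm q_ge3 P_ge3 /eqP.
rewrite -subr_eq0 => /eqP H.
(* With K = t P q and S = K b, the identity at 0 has the factor (P q)^2. The expression multiplied
   by q is at least P, while b^2 - e b is at most 2. *)
have : (P * q) ^+ 2 * (q * ((P - 2) * (t * b) + (P - 1) * q - e * t * (P - 1))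
    - (b ^+ 2 - e * b)) = 0.
  by rewrite -H; case: t_pm => ->; ring.
move/eqP; rewrite mulf_eq0 expf_eq0 /= mulf_eq0 -orbA => /or3P[|| /eqP {}H].
- by move: P_ge3; clear; lia.
- by move: q_ge3; clear; lia.
move: H; case: t_pm => ->; case: eE => ->; case: BE => ->; nia.
Qed.

(* Otherwise quadratic_spectrum at 0 would make p divide 4. *)
Lemma sign_at0 s : s ^+ 2 = 1 -> (forall a, a != 0 -> eps a = s) -> eps 0 = s.
Proof.
move=> s2 epsE; have [//|eps0] : eps 0 = s \/ eps 0 = - s.
  by case: (sign_pm1 s2) => ->; rewrite ?opprK; case: (sign_pm1 (eps_sign 0)); auto.
exfalso; set K := ps ^+ n./2; pose u := class_char (odd n) \o f.
have Q := quadratic_spectrum (u := u) (U := fun a => K * A a)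
  (r := (p%:Z - 2) * K * s) (t := (p%:Z - 1) * K ^+ 2) fourier_A.
have A_quad a : a != 0 ->
    (K * A a) ^+ 2 = (p%:Z - 2) * K * s * (K * A a) + (p%:Z - 1) * K ^+ 2.
  move=> a0; rewrite /A epsE // !exprMn s2 zero_char_sqr.
  by transitivity (K ^+ 2 * ((p%:Z - 2) * zero_char (g a) * s ^+ 2 + (p%:Z - 1)));
    [rewrite s2|]; ring.
have {Q A_quad} := Q A_quad 0.
pose psi := zero_char (g 0); pose q : int := p%:Z ^+ n./2.
have K2 : K ^+ 2 = q ^+ 2 by rewrite exprAC signed_prime_sqr exprAC.
(* If eps 0 = - s, the quadratic relation valid off 0 fails at 0 by this amount. *)
have -> : (K * A 0) ^+ 2 - (p%:Z - 2) * K * s * (K * A 0) - (p%:Z - 1) * K ^+ 2 =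
    q ^+ 2 * (2 * (p%:Z - 2) * psi).
  rewrite -K2 /A eps0 -/psi !exprMn sqrrN s2 zero_char_sqr -/psi.
  transitivity (K ^+ 2 * ((p%:Z - 2) * psi * (1 + s ^+ 2))); first by ring.
  by rewrite s2; ring.
have q_neq0 : q ^+ 2 != 0 by rewrite !expf_neq0 //; move: p_ge3; clear; lia.
(* For n odd the factor p comes from p^n = q^2 p. For n even the terms (p - 1) q^2 cancel and the
   others are multiples of K, which p divides. *)
suff div_p X : p%:Z * X = 2 * (p%:Z - 2) * psi -> False.
  rewrite eqxx mulr1; have [n_odd|n_even] := boolP (odd n).
    have -> : (p ^ n)%N%:Z = q ^+ 2 * p%:Z.
      rewrite -{1}(odd_double_half n) n_odd expnSr PoszM -muln2 expnM.
      by rewrite /q -!natz !natrX.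
    by rewrite -mulrA => /(mulfI q_neq0) /div_p.
  have pnE : (p ^ n)%N%:Z = q ^+ 2.
    rewrite -{1}(odd_double_half n) (negPf n_even) -muln2 expnM.
    by rewrite /q -!natz !natrX.
  rewrite pnE => /(mulfI q_neq0).
  have -> : convol u u 0 = (p%:Z - 2) * (K * A 0) + (p%:Z - 1) * q ^+ 2.
    have -> : K * A 0 = \sum_x zero_char (f x).
      apply: (@intr_inj C); rewrite -fourier_A fourier_at0 rmorph_sum (negPf
        n_even).
      exact: eq_bigr.
    rewrite -pnE -sum_sqr_zero_char; apply: eq_bigr => w _.
    by rewrite /u (negPf n_even) /= sub0r f_even.
  rewrite K2.
  have [c ->] : exists c, K = p%:Z * c.
    rewrite /K; have : (0 < n./2)%N by move: n_ge3; clear; lia.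
    case: (n./2) => // m _; rewrite exprS /ps; eexists.
    by rewrite [_ * p%:Z]mulrC -mulrA.
  have [d ->] : exists d, q = p%:Z * d.
    rewrite /q; have : (0 < n./2)%N by move: n_ge3; clear; lia.
    by case: (n./2) => // m _; rewrite exprS; eexists.
  move=> H; apply: (div_p ((p%:Z - 2) * (c * A 0) - (p%:Z - 2) * c * s * u 0)).
  by rewrite -H; ring.
(* psi is p - 1 or -1, and in both cases 2 (p - 2) psi is congruent to 4 modulo p. *)
move=> pX; have [Y pY] : exists Y, p%:Z * Y = 4.
  move: pX; rewrite /psi /zero_char; case: (g 0 == 0); rewrite ?mulr1n ?mulr0n => H.
    by exists (X - 2 * p%:Z + 6); rewrite mulrDr mulrBr H; ring.
  by exists (X + 2); rewrite mulrDr H; ring.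
have Y1 : Y = 1 by move: pY p_ge3; move: (p%:Z); clear; nia.
by move: pY p_odd; rewrite Y1 mulr1 => -[->].
Qed.

(** * A constant sign gives closure under convolution *)

Lemma in_class_span_mul (w : bool) (h : V -> 'F_p) (phi psi : V -> C) :
  in_class_span w h phi -> in_class_span w h psi ->
  in_class_span w h (fun x => phi x * psi x).
Proof.
have p0 : p%:R != 0 :> C by rewrite pnatr_eq0 -lt0n prime_gt0.
move=> [a0 [a1 [a2 [a3 [a3_0 phiE]]]]] [b0 [b1 [b2 [b3 [b3_0 psiE]]]]].
(* Products reduce by psi_0^2 = (p - 2) psi_0 + (p - 1), psi_0 psi_1 = - psi_1 and psi_1^2 = (p - 1
   - psi_0) / p; the indicator of 0 is then fitted at the origin. *)
pose r1 := a1 * b1 + a2 * b2 * (p%:R - 1) + a3 * b3 * (p%:R - 1) / p%:R.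
pose r2 := a1 * b2 + a2 * b1 + a2 * b2 * (p%:R - 2) - a3 * b3 / p%:R.
pose r3 := a1 * b3 + a3 * b1 - a2 * b3 - a3 * b2.
exists (phi 0 * psi 0 - (r1 + r2 * (zero_char (h 0))%:~R + r3 * (eta (h 0))%:~R)).
exists r1, r2, r3; split.
  by move=> w0; rewrite /r3 a3_0 // b3_0 //; ring.
move=> x; have [->|x0] := eqVneq x 0; first by rewrite mulr1; ring.
rewrite phiE psiE (negPf x0) !mulr0 !add0r /zero_char /quad_char.
have [hx|hx] := eqVneq (h x) 0; last case: (h x \in SQ p);
  rewrite rmorphB rmorphMn /= ?mulr1n ?mulr0n /r1 /r2 /r3 -?[p%:~R]/(p%:R);
    by field.
Qed.

Definition fourier_swaps_classes (h1 h2 : V -> 'F_p) :=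
  forall b : bool, exists c : C, forall a,
    fourier z (fun x => (class_char b (h1 x))%:~R) a =
      c * (class_char (odd n (+) b) (h2 a))%:~R.

(** The indicator of 0 and the constant 1 are exchanged up to scalars. For odd n, psi_0 is sent to a
    multiple of psi_1, so the span without psi_1 is treated for even n only. *)
Lemma in_class_span_fourier (w : bool) (h1 h2 : V -> 'F_p) (phi : V -> C) :
  fourier_swaps_classes h1 h2 -> w || ~~ odd n ->
  in_class_span w h1 phi -> in_class_span w h2 (fourier z phi).
Proof.
move=> swap w_or [c0 [c1 [c2 [c3 [c3_0 phiE]]]]].
have [[d2 d2E] [d3 d3E]] := (swap false, swap true).
have phiE' x : phi x = c0 * (x == 0)%:R + (c1 * 1
    + (c2 * (class_char false (h1 x))%:~R + c3 * (class_char true (h1 x))%:~R)).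
  by rewrite phiE mulr1 !addrA.
have E a : fourier z phi a = c1 * (p ^ n)%:R * (a == 0)%:R + c0
    + c2 * d2 * (class_char (odd n) (h2 a))%:~R
    + c3 * d3 * (class_char (~~ odd n) (h2 a))%:~R.
  rewrite (eq_fourier z phiE') !fourierD !fourierZ d2E d3E addbF addbT.
  rewrite fourier_delta // fourier1 // -mulr_natr; ring.
have [n_odd|n_even] := boolP (odd n).
  exists (c1 * (p ^ n)%:R), c0, (c3 * d3), (c2 * d2); split=> [w0|a].
    by move: w_or; rewrite n_odd (negPf w0).
  by rewrite E n_odd addrAC.
exists (c1 * (p ^ n)%:R), c0, (c2 * d2), (c3 * d3); split=> [w0|a].
  by rewrite c3_0 // mul0r.
by rewrite E (negPf n_even).
Qed.

Lemma in_class_span_convol (s : int) (w : bool) (phi psi : V -> C) :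
  (forall a, eps a = s) -> w || ~~ odd n ->
  in_class_span w f phi -> in_class_span w f psi -> in_class_span w f (convol
    phi psi).
Proof.
move=> epsE w_or phi_span psi_span.
have s_neq0 : s != 0 by rewrite -(epsE 0); apply: contra_eq_neq (eps_sign 0) => ->.
have fg : fourier_swaps_classes f g.
  move=> b; exists (ps ^+ (n./2 + (odd n && ~~ b)) * s)%:~R => a.
  by rewrite (fourier_class_char b a) epsE rmorphM.
have pn0 : (p ^ n)%:R != 0 :> C by rewrite pnatr_eq0 -lt0n expn_gt0 prime_gt0.
(* Fourier inversion of [fg]; the evenness of f absorbs the reflection. *)
have gf : fourier_swaps_classes g f.
  move=> b; pose c : C := (ps ^+ (n./2 + (odd n && ~~ (odd n (+) b))) * s)%:~R.
  have c0 : c != 0 by rewrite intr_eq0 mulf_neq0 ?expf_neq0.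
  exists ((p ^ n)%:R / c) => a.
  have /eq_fourier E : fourier z (fun x => (class_char (odd n (+) b) (f x))%:~R) =1
      (fun x => c * (class_char b (g x))%:~R).
    by move=> x; rewrite (fourier_class_char _ x) epsE addKb rmorphM.
  have := fourierK p_prime z_neq1 zp1 (fun x =>
    (class_char (odd n (+) b) (f x))%:~R : C) (- a).
  rewrite opprK E fourierZ f_even => H.
  by apply: (mulfI c0); rewrite H mulrA [c * _]mulrC mulfVK.
have conv_span : in_class_span w g (fourier z (convol phi psi)).
  have := in_class_span_mul (in_class_span_fourier fg w_or phi_span)
                            (in_class_span_fourier fg w_or psi_span).
  case=> c0 [c1 [c2 [c3 [c3_0 cE]]]]; exists c0, c1, c2, c3; split=> // x.
  by rewrite -cE fourier_convol.
have [c0 [c1 [c2 [c3 [c3_0 cE]]]]] := in_class_span_fourier gf w_or conv_span.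
exists (c0 / (p ^ n)%:R), (c1 / (p ^ n)%:R), (c2 / (p ^ n)%:R), (c3 / (p ^ n)%:R).
split=> [w0|x]; first by rewrite c3_0 // mul0r.
apply: (mulfI pn0); rewrite -(fourierK p_prime z_neq1 zp1) cE oppr_eq0 f_even.
by field.
Qed.

(** * Closure under convolution forces a constant sign *)

Let AB (c : bool) a := eps a * class_char c (g a).

(** Transform a convolution of two class functions: off 0 the constant 1 has transform 0 and the
    indicator of 0 gives x. For V the term psi_1 o f is absent; its spectrum is a multiple of A or B
    according to the parity of n. Rational coefficients allow order arguments later. *)
Lemma spectral_relation (w b b' : bool) :
  (forall phi psi : V -> rat, in_class_span w f phi -> in_class_span w f psi ->
     in_class_span w f (convol phi psi)) ->
  w || [&& odd n == b & odd n == b'] ->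
  exists x y t : rat, (~~ w -> (if odd n then y else t) = 0) /\
    forall a, a != 0 -> (AB b a * AB b' a)%:~R = x + y * (A a)%:~R + t * (B a)%:~R.
Proof.
move=> closed w_or.
pose kap c : int := ps ^+ (n./2 + (odd n && ~~ c)).
have kap0 c : (kap c)%:~R != 0 :> rat by rewrite intr_eq0 expf_neq0.
pose u c := class_char (odd n (+) c) \o f.
have uE c a : fourier z (intr \o u c) a = (kap (odd n (+) c) * AB c a)%:~R.
  by rewrite (fourier_class_char (odd n (+) c) a) addKb mulrA.
have span_u c : w || (odd n == c) -> in_class_span w f (intr \o u c : V -> rat).
  rewrite /u; case: (odd n (+) c) (addbC (odd n) c) => e.
    move=> w'; exists 0, 0, 0, 1; split=> [w0|x];
      last by rewrite !mul0r !add0r mul1r.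
    by move: w' e; rewrite (negPf w0) /= => /eqP ->; case: c.
  by exists 0, 0, 1, 0; split=> // x; rewrite !mul0r !add0r mul1r addr0.
have [b_ok b'_ok] : (w || (odd n == b)) /\ (w || (odd n == b')).
  by move: w_or; case: (w) => //= /andP[-> ->].
have [c0 [c1 [c2 [c3 [c3_0 cE]]]]] := closed _ _ (span_u b b_ok) (span_u b' b'_ok).
pose K : rat := (kap (odd n (+) b))%:~R * (kap (odd n (+) b'))%:~R.
have K0 : K != 0 by rewrite mulf_neq0.
have relH a : a != 0 -> K * (AB b a * AB b' a)%:~R =
    c0 + c2 * (kap false * AB (odd n) a)%:~R + c3 * (kap true * AB (~~ odd n)
      a)%:~R.
  move=> a0; apply: (fmorph_inj (ratr : {rmorphism rat -> C})).
  have cE' x : convol (intr \o u b) (intr \o u b') x =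
      ratr c0 * (x == 0)%:R + (ratr c1 * 1 + (ratr c2 * (class_char false (f x))%:~R
        + ratr c3 * (class_char true (f x))%:~R)) :> C.
    have := congr1 (ratr : rat -> C) (cE x).
    rewrite !convol_intr ratr_int => ->.
    by rewrite !(rmorphD, rmorphM) /= !ratr_int rmorph_nat mulr1 !addrA.
  have := fourier_convol p_prime zp1 (intr \o u b) (intr \o u b') a.
  rewrite (eq_fourier z cE') !fourierD !fourierZ fourier_delta // fourier1 // !uE.
  have := uE (odd n) a; have := uE (~~ odd n) a.
  rewrite /u addbb addbN addbb /= => -> ->.
  rewrite (negPf a0) mulr0n mulr0 mulr1 add0r addrA => E.
  have -> : K * (AB b a * AB b' a)%:~R =
      (kap (odd n (+) b) * AB b a * (kap (odd n (+) b') * AB b' a))%:~R.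
    by rewrite /K !rmorphM /=; ring.
  by rewrite ratr_int [in LHS]rmorphM /= -E !(rmorphD, rmorphM) /= !ratr_int.
exists (c0 / K).
have [n_odd|n_even] := boolP (odd n).
  exists (c3 * (kap true)%:~R / K), (c2 * (kap false)%:~R / K); split=> [w0|a a0].
    by rewrite c3_0 // !mul0r.
  apply: (mulfI K0); rewrite relH // n_odd /AB /= -/(A a) -/(B a) !rmorphM /=.
  by field.
exists (c2 * (kap false)%:~R / K), (c3 * (kap true)%:~R / K); split=> [w0|a a0].
  by rewrite c3_0 // !mul0r.
apply: (mulfI K0); rewrite relH // (negPf n_even) /AB /= -/(A a) -/(B a)
  !rmorphM /=.
by field.
Qed.

Let val0 a : g a = 0 -> (A a = eps a * (p%:Z - 1)) * (B a = 0).
Proof. by move=> ga; rewrite /A /B ga quad_char0 mulr0 /zero_char eqxx. Qed.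

Let valS a : eta (g a) = 1 -> (A a = - eps a) * (B a = eps a).
Proof.
move=> ga; have /andP[/negPf ga0 _] := quad_char_SQ ga.
by rewrite /A /B ga /zero_char ga0 mulr1 sub0r mulrN1.
Qed.

Let valN a : eta (g a) = -1 -> (A a = - eps a) * (B a = - eps a).
Proof.
move=> ga; have /andP[/negPf ga0 _] := quad_char_NSQ ga.
by rewrite /A /B ga /zero_char ga0 sub0r mulrN1.
Qed.

Let classes a : [\/ g a = 0, eta (g a) = 1 | eta (g a) = -1].
Proof.
rewrite /quad_char; have [->|_] := eqVneq (g a) 0; first by constructor 1.
by case: (g a \in SQ p); [constructor 2|constructor 3].
Qed.

Let eps_pm a : eps a = 1 \/ eps a = -1 := sign_pm1 (eps_sign a).

Lemma sign_const_U :
  (forall phi psi : V -> rat, in_class_span true f phi -> in_class_span true f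
    psi ->
     in_class_span true f (convol phi psi)) ->
  exists2 s, s ^+ 2 = 1 & forall a, eps a = s.
Proof.
move=> closed.
have [x [y [t [_ AA]]]] := spectral_relation (b := false) (b' := false) closed isT.
have [x' [y' [t' [_ AB_]]]] := spectral_relation (b := false) (b' := true)
  closed isT.
rewrite /AB /= -/(A _) -/(B _) in AA AB_.
have [[a0 a0_neq ga0] [a1 a1_neq ga1] [a2 a2_neq ga2]] := g_levels.
have P3 : 3 <= p%:R :> rat by rewrite -[p%:R]/(p%:Z%:~R) (ler_int _ 3).
pose P : rat := p%:R.
have e_sqr a : (eps a)%:~R * (eps a)%:~R =
  1 :> rat by rewrite -rmorphM -expr2 eps_sign.
have e_pm a : (eps a)%:~R = 1 :> rat \/ (eps a)%:~R = -1 :> rat.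
  by case: (eps_pm a) => ->; [left|right].
have E0 a : a != 0 -> g a = 0 ->
    (P - 1) ^+ 2 = x + y * ((eps a)%:~R * (P - 1)) /\
    0 = x' + y' * ((eps a)%:~R * (P - 1)).
  move=> a_neq ga; have := AA a a_neq; have := AB_ a a_neq.
  rewrite -/(A _) -/(B _) !val0 // !(rmorphM, rmorphB, rmorph1, rmorph0)
    /= -[p%:~R]/P => H' H.
  split; last by move: H'; lra.
  have -> : (P - 1) ^+ 2 = (eps a)%:~R * (eps a)%:~R * (P - 1)
    ^+ 2 by rewrite e_sqr mul1r.
  by move: H; lra.
have E1 a : a != 0 -> eta (g a) = 1 ->
    1 = x - y * (eps a)%:~R + t * (eps a)%:~R /\
    -1 = x' - y' * (eps a)%:~R + t' * (eps a)%:~R.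
  move=> a_neq ga; have := AA a a_neq; have := AB_ a a_neq.
  by rewrite -/(A _) -/(B _) !valS // !(rmorphM, rmorphN)
    /= mulrNN mulNr !e_sqr !mulrN.
have E2 a : a != 0 -> eta (g a) = -1 ->
    1 = x - y * (eps a)%:~R - t * (eps a)%:~R /\
    1 = x' - y' * (eps a)%:~R - t' * (eps a)%:~R.
  move=> a_neq ga; have := AA a a_neq; have := AB_ a a_neq.
  by rewrite -/(A _) -/(B _) !valN // !(rmorphM, rmorphN) /= mulrNN !e_sqr !mulrN.
have e_inj a b : (eps a)%:~R = (eps b)%:~R :> rat -> eps a = eps b by move/intr_inj.
(* On the zero level A^2 = (p - 1)^2, which exceeds 1. *)
have y_neq0 : x = 1 -> y = 0 -> False.
  move=> x1 y0; have [] := E0 a0 a0_neq ga0; rewrite x1 y0 mul0r addr0.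
  by move=> H _; move: H P3; rewrite -/P; nra.
(* Both signs on the zero level would give y = y' = x' = 0. The relation for A B then equates the
   signs at [a1] and [a2], and the one for A^2 gives t = 0 and x = 1. *)
have S0 a : a != 0 -> g a = 0 -> eps a = eps a0.
  move=> a_neq ga; apply: e_inj; have [H _] := E0 _ a_neq ga;
    have [H0 H0'] := E0 _ a0_neq ga0.
  have [_ H'] := E0 _ a_neq ga.
  have [H1 H1'] := E1 _ a1_neq ga1; have [H2 H2'] := E2 _ a2_neq ga2.
  case: (e_pm a) (e_pm a0) => ea [] ea0; rewrite ?ea ?ea0 // in H H' H0 H0' *;
    exfalso.
    have y0 : y = 0 by move: H H0 P3; rewrite -/P; nra.
    have y'0 : y' = 0 by move: H' H0' P3; rewrite -/P; nra.
    have x'0 : x' = 0 by move: H'; rewrite y'0; lra.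
    apply: y_neq0 => //; move: H1 H2 H1' H2'; rewrite y0 y'0 x'0.
    by case: (e_pm a1) => ->; case: (e_pm a2) => ->; lra.
  have y0 : y = 0 by move: H H0 P3; rewrite -/P; nra.
  have y'0 : y' = 0 by move: H' H0' P3; rewrite -/P; nra.
  have x'0 : x' = 0 by move: H'; rewrite y'0; lra.
  apply: y_neq0 => //; move: H1 H2 H1' H2'; rewrite y0 y'0 x'0.
  by case: (e_pm a1) => ->; case: (e_pm a2) => ->; lra.
(* Both signs on the squares would give x = 1 and y = t, and the relation at a nonsquare then forces
   y = 0. *)
have S1 a : a != 0 -> eta (g a) = 1 -> eps a = eps a1.
  move=> a_neq ga; apply: e_inj; have [H _] := E1 _ a_neq ga.
  have [H1 _] := E1 _ a1_neq ga1; have [H2 _] := E2 _ a2_neq ga2.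
  case: (e_pm a) (e_pm a1) => ea [] ea1; rewrite ?ea ?ea1 // in H H1 *; exfalso;
    by apply: y_neq0; move: H H1 H2; case: (e_pm a2) => ->; lra.
have S2 a : a != 0 -> eta (g a) = -1 -> eps a = eps a2.
  move=> a_neq ga; apply: e_inj; have [H _] := E2 _ a_neq ga.
  have [H1 _] := E1 _ a1_neq ga1; have [H2 _] := E2 _ a2_neq ga2.
  case: (e_pm a) (e_pm a2) => ea [] ea2; rewrite ?ea ?ea2 // in H H2 *; exfalso;
    by apply: y_neq0; move: H H1 H2; case: (e_pm a1) => ->; lra.
have [e12|e12] : eps a2 = eps a1 \/ eps a2 = - eps a1.
  by case: (eps_pm a1) => ->; case: (eps_pm a2) => ->; auto.
  have [e01|e01] : eps a0 = eps a1 \/ eps a0 = - eps a1.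
    by case: (eps_pm a1) => ->; case: (eps_pm a0) => ->; auto.
    have epsE a : a != 0 -> eps a = eps a1.
      by move=> a_neq; case: (classes a) => [/S0|/S1|/S2] ->.
    have eps0 := sign_at0 (eps_sign a1) epsE.
    by exists (eps a1) => // a; have [->|/epsE] := eqVneq a 0.
  (* With e = eps a0, off the origin A is e (p - 1) on the zero level and e elsewhere: the roots of
     X^2 - e p X + (p - 1). *)
  exfalso; apply: (no_quadratic_A (eps_sign a0)) => a a_neq.
  case: (classes a) => ga; [rewrite val0 // S0 //|rewrite valS // S1 //|rewrite
    valN // S2 // e12];
    rewrite ?e01 ?exprMn ?sqrrN eps_sign; have := eps_sign a1; clear; nia.
(* Off the origin B is 0 on the zero level and eps a1 on squares and nonsquares alike. *)
exfalso; apply: (no_quadratic_B (eps_sign a1)) => a a_neq.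
by case: (classes a) => ga; [rewrite val0 //|rewrite valS // S1 //|rewrite valN
  // S2 // e12];
  rewrite ?expr0n ?mulr0 ?opprK ?expr2.
Qed.

Lemma sign_const_V :
  (forall phi psi : V -> rat, in_class_span false f phi -> in_class_span false
    f psi ->
     in_class_span false f (convol phi psi)) ->
  ~~ odd n /\ exists2 s, s ^+ 2 = 1 & forall a, eps a = s.
Proof.
move=> closed.
have [[a0 a0_neq ga0] [a1 a1_neq ga1] _] := g_levels.
have e_sqr a : (eps a)%:~R * (eps a)%:~R =
  1 :> rat by rewrite -rmorphM -expr2 eps_sign.
have e_pm a : (eps a)%:~R = 1 :> rat \/ (eps a)%:~R = -1 :> rat.
  by case: (eps_pm a) => ->; [left|right].
have e_inj a b : (eps a)%:~R = (eps b)%:~R :> rat -> eps a = eps b by move/intr_inj.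
(* For n odd the spectrum of psi_0 o f is a multiple of B, and B^2 = x + t B off 0; the zero level
   gives x = 0 and a square gives t = eps a1. *)
have [n_odd|n_even] := boolP (odd n).
  have := spectral_relation (b := true) (b' := true) closed; rewrite n_odd /=.
  case=> // x [y [t [y0 BB]]]; rewrite /AB /= -/(B _) in BB.
  have x0 : x = 0.
    by have := BB a0 a0_neq; rewrite -/(B _)
      val0 // y0 // !mul0r rmorph0 mulr0 !addr0.
  exfalso; apply: (no_quadratic_B (eps_sign a1)) => a a_neq.
  apply: (@intr_inj rat); rewrite expr2 [LHS]BB // x0 y0 // mul0r !add0r rmorphM /=.
  suff tE : t = (eps a1)%:~R by rewrite tE -?rmorphM.
  have := BB a1 a1_neq; rewrite -/(B _)
    valS // x0 y0 // mul0r !add0r rmorphM /= e_sqr.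
  by case: (e_pm a1) => ->; lra.
have := spectral_relation (b := false) (b' := false) closed;
  rewrite (negPf n_even) /=.
case=> // x [y [t [t0 AA]]]; rewrite /AB /= -/(A _) in AA; split=> //.
have P3 : 3 <= p%:R :> rat by rewrite -[p%:R]/(p%:Z%:~R) (ler_int _ 3).
pose P : rat := p%:R.
have E0 a : a != 0 -> g a = 0 ->
    (P - 1) ^+ 2 = x + y * ((eps a)%:~R * (P - 1)).
  move=> a_neq ga; have := AA a a_neq.
  rewrite -/(A _) !val0 // t0 // !(rmorphM, rmorphB, rmorph1, rmorph0)
    /= -[p%:~R]/P => H.
  have -> : (P - 1) ^+ 2 = (eps a)%:~R * (eps a)%:~R * (P - 1)
    ^+ 2 by rewrite e_sqr mul1r.
  by move: H; lra.
have E1 a : a != 0 -> g a != 0 ->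
    A a = - eps a /\ 1 = x - y * (eps a)%:~R.
  move=> a_neq ga; have AE : A a = - eps a.
    by case: (classes a) => ga'; [rewrite ga' eqxx in ga|rewrite valS|rewrite valN].
  split=> //; have := AA a a_neq.
  by rewrite -/(A _) AE t0 // mul0r addr0 rmorphM !rmorphN /= mulrNN e_sqr mulrN.
have ga1_neq : g a1 != 0 by have /andP[] := quad_char_SQ ga1.
have S0 a : a != 0 -> g a = 0 -> eps a = eps a0.
  move=> a_neq ga; apply: e_inj.
  have H := E0 _ a_neq ga; have H0 := E0 _ a0_neq ga0;
    have [_ H1] := E1 _ a1_neq ga1_neq.
  case: (e_pm a) (e_pm a0) => ea [] ea0; rewrite ?ea ?ea0 // in H H0 *; exfalso;
    have y0 : y = 0 by [move: H H0 P3; rewrite -/P; nra];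
    by move: H H1; rewrite y0; move: P3; rewrite -/P; nra.
have S1 a : a != 0 -> g a != 0 -> eps a = eps a1.
  move=> a_neq ga; apply: e_inj.
  have [_ H] := E1 _ a_neq ga; have H0 := E0 _ a0_neq ga0;
    have [_ H1] := E1 _ a1_neq ga1_neq.
  case: (e_pm a) (e_pm a1) => ea [] ea1; rewrite ?ea ?ea1 // in H H1 *; exfalso;
    have y0 : y = 0 by [lra];
    by move: H H0; rewrite y0; move: P3; rewrite -/P; nra.
have [e01|e01] : eps a0 = eps a1 \/ eps a0 = - eps a1.
  by case: (eps_pm a1) => ->; case: (eps_pm a0) => ->; auto.
  have epsE a : a != 0 -> eps a = eps a1.
    by move=> a_neq; have [/S0->|/S1->] := eqVneq (g a) 0.
  have eps0 := sign_at0 (eps_sign a1) epsE.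
  by exists (eps a1) => // a; have [->|/epsE] := eqVneq a 0.
exfalso; apply: (no_quadratic_A (eps_sign a0)) => a a_neq.
have [ga|ga] := eqVneq (g a) 0.
  by rewrite val0 // S0 // ?exprMn ?eps_sign; have := eps_sign a0; clear; nia.
have [-> _] := E1 a a_neq ga; rewrite S1 // e01 sqrrN eps_sign.
by have := eps_sign a1; clear; nia.
Qed.
End Spectrum.

(** * The complex root of unity *)

Section ComplexRoot.
Variables (R : realType) (p : nat).
Hypotheses (p_prime : prime p) (p_odd : odd p).
Local Notation z := (xi R p).

Lemma xi_expr k :
  z ^+ k = Complex (cos (2 * pi / p%:R *+ k)) (sin (2 * pi / p%:R *+ k)).
Proof.
elim: k => [|k IHk]; first by rewrite expr0 !mulr0n cos0 sin0.
rewrite exprS IHk (mulrS (2 * pi / _) k) cosD sinD /xi; simpc.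
by rewrite [in X in Complex _ X]addrC.
Qed.

Lemma xi_expr_p : z ^+ p = 1.
Proof.
rewrite xi_expr -mulr_natr divfK ?pnatr_eq0 -?lt0n ?prime_gt0 //.
by rewrite mulr_natl cos2pi sin2pi.
Qed.

Lemma xi_neq1 : z != 1.
Proof.
have p_gt2 : (2 < p)%N by have := prime_gt1 p_prime; move: p_odd; clear; lia.
have p_gt0 : 0 < p%:R :> R by rewrite ltr0n prime_gt0.
apply/eqP => -[_ sin0].
have : 0 < sin (2 * pi / p%:R : R).
  apply: sin_gt0_pi; rewrite divr_gt0 ?mulr_gt0 ?pi_gt0 //=.
  by rewrite ltr_pdivrMr // mulrC ltr_pM2l ?pi_gt0 // ltr_nat.
by rewrite sin0 ltxx.
Qed.
Local Notation G := (gauss_sum p z).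

Lemma phalf_sqr n : phalf R p n ^+ 2 = (p ^ n)%:R.
Proof.
rewrite /phalf -rmorphXn /= -exprM mulnC exprM sqr_sqrtr ?ler0n //.
by rewrite natrX rmorphXn rmorph_nat.
Qed.

Lemma mu_sqr n : mu R p n ^+ 2 = (-1) ^+ (p./2 * n).
Proof.
have p4 : (p %% 4 = if odd p./2 then 3 else 1)%N.
  by move: p_odd; clear; case: ifP; lia.
have pn4 : (p ^ n %% 4 = if odd (p./2 * n) then 3 else 1)%N.
  elim: n => [|m IHm]; first by rewrite muln0.
  rewrite expnS -modnMm IHm p4 mulnS oddD.
  by case: (odd p./2); case: (odd (p./2 * m)).
rewrite /mu pn4 -signr_odd; case: (odd _) => /=; last by rewrite expr1n.
by rewrite sqr_i.
Qed.

(** Both sides have the same square, (-1)^(p./2 n) p^n. *)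
Lemma mu_phalf n : exists2 s : int, s ^+ 2 = 1 & mu R p n * phalf R p n =
  s%:~R * G ^+ n.
Proof.
have /eqP : (mu R p n * phalf R p n) ^+ 2 = (G ^+ n) ^+ 2.
  rewrite exprMn phalf_sqr mu_sqr exprAC gauss_sum_sqr ?xi_neq1 ?xi_expr_p //.
  by rewrite exprMn -exprM natrX.
rewrite eqf_sqr => /orP[]/eqP ->; [exists 1|exists (-1)] => //.
  by rewrite mul1r.
by rewrite rmorphN mulN1r.
Qed.
End ComplexRoot.

Theorem proposition8 (R : realType) (p n : nat) (f : 'rV['F_p]_n -> 'F_p)
    (p_prime : prime p) (p_odd : odd p) (n_ge3 : (3 <= n)%N)
    (fDBF : DBF R f) :
  (induces_sym_scheme (partU f) <-> weakly_regular R f) /\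
  (induces_sym_scheme (partV f) <-> (weakly_regular R f /\ ~~ odd n)).
Proof.
have [[f_bent [g fg g_bent]] f0 [h [h_gt0 h_coprime h_homog]]] := fDBF.
set z := xi R p; have z_neq1 : z != 1 := xi_neq1 R p_prime p_odd.
have zp1 : z ^+ p = 1 := xi_expr_p R p_prime.
have [k hE] : exists k, h = k.+1 by exists h.-1; rewrite prednK.
have k_coprime : coprime k (p - 1) by rewrite hE subn1 in h_coprime.
have f_homog a x : a != 0 -> f (a *: x) = a ^+ k.+1 * f x by rewrite -hE;
  apply: h_homog.
have [s0 s0_sqr muE] := mu_phalf R p_prime p_odd n.
have levels (e : 'rV['F_p]_n -> 'F_p) : bent R e ->
    [/\ exists2 x, x != 0 & e x = 0, exists2 x, x != 0 & quad_char (e x) = 1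
       & exists2 x, x != 0 & quad_char (e x) = -1].
  move=> e_bent; apply: (levels_nonempty (z := z)) => //.
  rewrite -(phalf_sqr R) -(e_bent 0); congr (`|_| ^+ 2); apply: eq_bigr => x _.
  by rewrite dotpC dotp0r subr0.
pose G := gauss_sum p z.
have G0 : G != 0 by apply: gauss_sum_neq0.
(* The sign is measured against G^n, which differs from mu p^(n/2) by the global sign s0. *)
pose eps a : int := if walsh R f a == G ^+ n * add_char z (g a) then 1 else -1.
have eps_sqr a : eps a ^+ 2 = 1 by rewrite /eps; case: ifP.
have walshE a : \sum_x add_char z (f x - dotp a x) =
  (eps a)%:~R * G ^+ n * add_char z (g a).
  have : walsh R f a = G ^+ n * add_char z (g a) \/ walsh R f a =
    - (G ^+ n * add_char z (g a)).
    have := fg a; rewrite muE.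
    by case: (sign_pm1 s0_sqr) => ->;
      rewrite ?rmorphN ?mulNr mul1r ?opprK => -[->|->]; auto.
  change (\sum_x _) with (walsh R f a); rewrite /eps.
  by case: eqP => [E|_ [//|E]] //; rewrite E ?mul1r // rmorphN mulN1r mulNr.
have wr_const : weakly_regular R f <-> exists2 s, s ^+ 2 = 1 & forall a, eps a = s.
  split=> [[_ [g' _ [l _ lE]]]|[s s_sqr epsE]].
    exists (eps 0) => // a.
    (* The p-th power kills the values of chi, whichever dual is used, and keeps the sign since p is
       odd. *)
    have epsp b : (eps b)%:~R * (G ^+ n) ^+ p = (l * phalf R p n) ^+ p.
      have := congr1 (fun c => c ^+ p) (etrans (esym (walshE b)) (lE b)).
      rewrite !exprMn -/z -[z ^+ _]/(add_char z (g' b))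
        !add_char_exp_p // !mulr1 => <-.
      congr (_ * _); rewrite -rmorphXn /=; case: (sign_pm1 (eps_sqr b)) => ->;
        rewrite ?expr1n //.
      by rewrite -signr_odd p_odd.
    have := etrans (epsp a) (esym (epsp 0)) => /mulIf.
    by rewrite !expf_neq0 // => /(_ isT) /intr_inj.
  split=> //; exists g => //; exists ((s * s0)%:~R * mu R p n).
    rewrite /mu; case: (sign_pm1 s_sqr) => ->; case: (sign_pm1 s0_sqr) => ->;
      case: ifP => _;
      by rewrite ?mulrN ?mulNr ?mul1r ?opprK ?rmorphN ?mulNr ?mul1r !inE eqxx ?orbT.
  move=> a; rewrite [LHS]walshE epsE -[_ * _ * phalf R p n]mulrA muE mulrA.
  by rewrite -rmorphM -(mulrA s) -expr2 s0_sqr mulr1.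
have f_levels := levels f f_bent; have g_levels := levels g g_bent.
have f_even := homog_even p_prime p_odd k_coprime f_homog.
split; split.
(* Closure is exploited over [rat] and established over [R[i]]; the scheme condition is equivalent
   to either. *)
- move/(induces_partU p_prime f0 f_even f_levels rat) => closed.
  apply/wr_const; exact: (sign_const_U p_prime p_odd z_neq1 zp1 k_coprime
    f_homog f0 walshE).
- case/wr_const=> s s_sqr epsE.
  apply/(induces_partU p_prime f0 f_even f_levels R[i]) => phi psi.
  exact: (in_class_span_convol p_prime p_odd z_neq1 zp1 k_coprime f_homog walshE).
- move/(induces_partV p_prime f0 f_even f_levels rat) => closed.
  have [n_even const] := sign_const_V p_prime p_odd z_neq1 zp1 k_coprime
    f_homog f0 walshE eps_sqr n_ge3 f_levels g_levels closed.
  by split=> //; apply/wr_const.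
case=> /wr_const[s s_sqr epsE] n_even.
apply/(induces_partV p_prime f0 f_even f_levels R[i]) => phi psi.
exact: (in_class_span_convol p_prime p_odd z_neq1 zp1 k_coprime f_homog walshE).
Qed.
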